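(* Let $0<s<1$ and $a>1$, let $\mathcal{H}_s$, its closed subspace $\mathcal{K}_s$, and the unitary operator $U=U(a)$ on $\mathcal{H}_s$ be as defined in the context, and let $P$ be the orthogonal projection of $\mathcal{H}_s$ onto $\mathcal{K}_s$. Then the isometry $UP$, regarded as the isometry $U(a)|_{\mathcal{K}_s}\colon\mathcal{K}_s\to\mathcal{K}_s$, is a pure shift.
   Context: For $0<s<1$, $\mathcal{H}_s$ is the Hilbert space obtained by completing $C_c(\mathbb{R})$ (continuous compactly supported complex functions) in the norm of the inner product $$\langle f_1,f_2\rangle_{\mathcal{H}_s}=\int_{\mathbb{R}}\int_{\mathbb{R}}\overline{f_1(x)}\,|x-y|^{s-1}f_2(y)\,dx\,dy .$$ $\mathcal{K}_s$ is the closure of $C_c(-1,1)$ in $\mathcal{H}_s$. For $a>0$, $U(a)$ is the unitary operator on $\mathcal{H}_s$ determined by $(U(a)f)(x)=a^{s+1}f(a^{2}x)$; for $a>1$ it maps $\mathcal{K}_s$ into itself. An isometry $V$ on a Hilbert space $\mathcal{K}$ is a pure shift if the unitary part in its Wold decomposition is trivial, equivalently $\lim_{k\to\infty}\|V^{*k}\varphi\|=0$ for all $\varphi\in\mathcal{K}$. *)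

(* Defs.v *)
From HB Require Import structures.
From mathcomp Require Import all_boot all_order all_algebra.
From mathcomp Require Import sesquilinear complex.
From mathcomp Require Import all_classical all_reals all_analysis.

Set Implicit Arguments.
Unset Strict Implicit.
Unset Printing Implicit Defensive.

Import Order.TTheory GRing.Theory Num.Theory.
Import numFieldNormedType.Exports.

Local Open Scope classical_set_scope.
Local Open Scope ring_scope.
Local Open Scope complex_scope.

Definition Cc (R : realType) (f : R -> R[i]) : Prop :=
  continuous (f : R -> (R[i] : numFieldType)) /\
  compact (closure [set x | f x != 0]).

Definition Cc_on (R : realType) (O : set R) (f : R -> R[i]) : Prop :=
  Cc f /\ closure [set x | f x != 0] `<=` O.

Definition cintegral (R : realType) (f : R -> R[i]) : R[i] :=
  (\int[lebesgue_measure]_x complex.Re (f x)) +i* (\int[lebesgue_measure]_x complex.Im (f x)).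

(* At x = y the kernel takes the value 0 `^ (s - 1) = 0 (for s <> 1); for fixed
   y this is the single point x = y, hence irrelevant for the integral. *)
Definition riesz_form (R : realType) (s : R) (f1 f2 : R -> R[i]) : R[i] :=
  cintegral (fun y => cintegral (fun x =>
    (f1 x)^* * (`|x - y| `^ (s - 1))%:C * f2 y)).

Definition dilation (R : realType) (s a : R) (f : R -> R[i]) : R -> R[i] :=
  fun x => (a `^ (s + 1))%:C * f (a ^+ 2 * x).

Section Hilbert.
Variables (R : realType) (H : completeNormedModType R[i]).

(* The library's forms are linear on the left and antilinear on the right.
   The inner product <x, y>, antilinear in x and linear in y, is dot y x. *)
Variable dot : {dot H for Num.conj}.

Definition inner (x y : H) : R[i] := dot y x.

(* H is complete, so this makes (H, dot) a Hilbert space. *)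
Definition hilbert_norm : Prop := forall x : H, `|x| ^+ 2 = inner x x.

(* (H, dot) together with j : C_c(R) -> H is a Hilbert space completion of
   C_c(R) for the Riesz form; j is only constrained on C_c(R). *)
Record Hs_completion (s : R) (j : (R -> R[i]) -> H) : Prop := {
  Hs_norm : hilbert_norm ;
  Hs_linear : forall (c : R[i]) (f g : R -> R[i]), Cc f -> Cc g ->
    j (fun x => c * f x + g x) = c *: j f + j g ;
  Hs_inner : forall f g : R -> R[i], Cc f -> Cc g ->
    inner (j f) (j g) = riesz_form s f g ;
  Hs_dense : closure (j @` [set f | Cc f]) = [set: H] }.

Definition Ks (j : (R -> R[i]) -> H) : set H :=
  closure (j @` [set f | Cc_on `](-1), 1[ f]).

Definition unitary (U : H -> H) : Prop :=
  [/\ linear U, (forall x y, inner (U x) (U y) = inner x y) &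
      (forall y, exists x, U x = y)].

Definition orthogonal_projection (K : set H) (P : H -> H) : Prop :=
  forall x, K (P x) /\ (forall y, K y -> inner y (x - P x) = 0).

Definition closed_subspace (M : set H) : Prop :=
  [/\ closed M, M 0 &
      forall (c : R[i]) (x y : H), M x -> M y -> M (c *: x + y)].

Definition closed_span (A : set H) : set H :=
  [set x | forall M, closed_subspace M -> A `<=` M -> M x].

Definition orthogonal_sets (A B : set H) : Prop :=
  forall x y, A x -> B y -> inner x y = 0.

(* V is an isometry of the subspace K; nothing is said of V outside K. *)
Definition isometry_on (K : set H) (V : H -> H) : Prop :=
  [/\ (forall x, K x -> K (V x)),
      (forall (c : R[i]) (x y : H), K x -> K y ->
         V (c *: x + y) = c *: V x + V y) &
      (forall x, K x -> `|V x| = `|x|)].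

Definition wandering (M : set H) (V : H -> H) : set H :=
  [set x | M x /\ forall y, M y -> inner (V y) x = 0].

(* K is the orthogonal direct sum of Ku and Kp, where the isometry V of K
   restricts to a unitary operator of Ku, and to a unilateral shift of Kp:
   Kp is the closed span of the (mutually orthogonal) subspaces V^n L, with
   L the orthogonal complement of V Kp in Kp. *)
Record wold_decomposition (K : set H) (V : H -> H) (Ku Kp : set H) : Prop := {
  wold_u : closed_subspace Ku ;
  wold_p : closed_subspace Kp ;
  wold_orth : orthogonal_sets Ku Kp ;
  wold_sum : K = [set u + p | u in Ku & p in Kp] ;
  wold_unitary : V @` Ku = Ku ;
  wold_reduce : V @` Kp `<=` Kp ;
  wold_shift :
    Kp = closed_span (\bigcup_n (iter n V @` wandering Kp V)) }.

Definition pure_shift (K : set H) (V : H -> H) : Prop :=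
  isometry_on K V /\
  exists Ku Kp : set H, wold_decomposition K V Ku Kp /\ Ku = [set 0].

(* Vs restricts to the adjoint of V : K -> K; it is determined on K. *)
Definition adjoint_on (K : set H) (V Vs : H -> H) : Prop :=
  (forall y, K y -> K (Vs y)) /\
  (forall x y, K x -> K y -> inner (V x) y = inner x (Vs y)).

End Hilbert.

(* Main.v *)
Require Import Defs.
From HB Require Import structures.
From mathcomp Require Import all_boot all_order all_algebra.
From mathcomp Require Import sesquilinear complex.
From mathcomp Require Import all_classical all_reals all_analysis.
From mathcomp Require Import measurable_realfun ring lra.
Set Implicit Arguments.
Unset Strict Implicit.
Unset Printing Implicit Defensive.
Import Order.TTheory GRing.Theory Num.Theory.
Import numFieldNormedType.Exports.
Local Open Scope classical_set_scope.
Local Open Scope ring_scope.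
Local Open Scope complex_scope.

(** For [x <> y], integrating [(v - u)^(s-3)] over all [u < min x y] and
    [v > max x y] gives [|x - y|^(s-1) / ((1-s)(2-s))].  Hence, for real [f], [g],
    [<f, g> = (1-s)(2-s) \int\int_{u<v} (v-u)^(s-3) F(u,v) G(u,v) du dv]
    with [F(u,v) = \int_u^v f] and [G(u,v) = \int_u^v g].
    If [f_n] is bounded in norm and supported in [(-e_n, e_n)] with [e_n -> 0],
    then [F_n(u,v)] vanishes for [u], [v] on the same side of the support and
    equals [m_n = \int f_n] for [u < -e_n < e_n < v]; the latter region has mass
    of order [e_n^(s-1)], which tends to infinity, so [m_n -> 0].  Thus [F_n -> 0]
    almost everywhere while staying bounded in the weighted L^2 space, and
    [f_n -> 0] weakly.
    For [x] in [K_s], [U^n U^*n x] is a limit of functions supported in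
    [(-a^(-2n), a^(-2n))], so [||V^*n x||^2 = <U^n V^*n x, x> -> 0].  Telescoping
    [V^*n x = w_n + V V^*(n+1) x] with [w_n] wandering gives the Wold decomposition. *)

(** * Integrals of shifted powers and the slicing of the Riesz kernel *)

Lemma is_derive_powR_shift (R : realType) (c r x : R) : r != 0 -> c < x ->
  is_derive x 1 (fun t => (t - c) `^ r / r) ((x - c) `^ (r - 1)).
Proof.
move=> r0 cx.
have h1 : is_derive x (1:R) (fun t : R => t - c) 1.
  by apply: is_derive_eq; rewrite subr0.
have h2 : is_derive (x - c) (1:R) (fun t => t `^ r) (r * (x - c) `^ (r - 1)).
  by apply: is_derive1_powR; rewrite subr_gt0.
have h3 := @is_derive1_comp R (fun t => t `^ r) (fun t => t - c) x _ _ h2 h1.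
have -> : (fun t => (t - c) `^ r / r) = (r^-1 *: ((fun t => t `^ r) \o (fun t => t - c))).
  by apply/funext => t /=; rewrite /GRing.scale /= mulrC.
apply: is_derive_eq; rewrite mulr1 /GRing.scale /= mulrA mulVf// mul1r.
by [].
Qed.

Lemma continuous_powR_shift (R : realType) (c r x : R) : c < x ->
  {for x, continuous (fun t => (t - c) `^ r)}.
Proof.
move=> cx.
have h1 : is_derive x (1:R) (fun t : R => t - c) 1.
  by apply: is_derive_eq; rewrite subr0.
have h2 : is_derive (x - c) (1:R) (fun t => t `^ r) (r * (x - c) `^ (r - 1)).
  by apply: is_derive1_powR; rewrite subr_gt0.
have h3 := @is_derive1_comp R (fun t => t `^ r) (fun t => t - c) x _ _ h2 h1.
apply: differentiable_continuous; apply/derivable1_diffP.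
by case: h3.
Qed.

Lemma powR_shift_cvgy (R : realType) (c r : R) : r < 0 ->
  (x - c) `^ r @[x --> +oo%R] --> (0 : R).
Proof.
move=> r0.
apply/cvgrPdist_le => e e0.
near=> x.
have xc : e `^ (r^-1) <= x - c.
  by rewrite lerBrDr; near: x; apply: nbhs_pinfty_ge; rewrite num_real.
have ep : 0 < e `^ (r^-1) by apply: powR_gt0.
rewrite sub0r normrN ger0_norm ?powR_ge0//.
have : (x - c) `^ (- r) >= (e `^ (r^-1)) `^ (-r).
  apply: ge0_ler_powR => //; rewrite ?nnegrE ?oppr_ge0 ?(ltW r0)//.
    exact: ltW.
  exact: le_trans (ltW ep) xc.
rewrite -powRrM mulrN mulVf ?lt_eqF// !powRN powRr1 ?(ltW e0)// lef_pV2 ?posrE//.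
by apply: powR_gt0; exact: lt_le_trans xc.
Unshelve. all: by end_near. Qed.

Lemma integral_powR_ray (R : realType) (c d r : R) : c < d -> r < -1 ->
  (\int[lebesgue_measure]_(x in `[d, +oo[) ((x - c) `^ r)%:E
   = (- ((d - c) `^ (r + 1) / (r + 1)))%:E)%E.
Proof.
move=> cd r1.
have r0 : r + 1 != 0 by rewrite lt_eqF// -ltrBrDr sub0r.
(* The argument [0] is the limit of the antiderivative at infinity, where the exponent [r + 1] is
   negative. *)
rewrite (@ge0_continuous_FTC2y R _ (fun t => (t - c) `^ (r + 1) / (r + 1)) d 0).
- by rewrite EFinN add0e.
- by move=> x _; apply: powR_ge0.
- apply: continuous_in_subspaceT => x; rewrite inE/= in_itv/= andbT => dx.
  by apply: continuous_powR_shift; apply: lt_le_trans dx.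
- rewrite -[X in _ --> X](mul0r (r+1)^-1); apply: cvgMl.
  by apply: powR_shift_cvgy; lra.
- by move=> x dx; have [] := is_derive_powR_shift r0 (lt_trans cd dx).
- apply: cvg_at_right_filter; apply: cvgMl.
  exact: continuous_powR_shift.
- move=> x; rewrite in_itv/= andbT => dx.
  rewrite derive1E.
  have := is_derive_powR_shift r0 (lt_trans cd dx) => h.
  by rewrite derive_val addrK.
Qed.

Lemma measurable_powR_sub d (T : measurableType d) (R : realType) (r : R)
    (f g : T -> R) :
  measurable_fun setT f -> measurable_fun setT g ->
  measurable_fun setT (fun t => (f t - g t) `^ r).
Proof.
move=> mf mg.
have -> : (fun t => (f t - g t) `^ r) = (@powR R ^~ r) \o (fun t => f t - g t) by [].
by apply: measurableT_comp => //; apply: measurable_funB.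
Qed.

(** The antiderivative is applied on the intervals [F i], which avoid the singularity at [c].
    Dropping the nonnegative boundary term at [d i] leaves a bound uniform in [i], and monotone
    convergence carries it to the union. *)
Lemma le_integral_powR_sing (R : realType) (c b r : R) : c < b -> -1 < r ->
  (\int[lebesgue_measure]_(x in `]c, b]) ((x - c) `^ r)%:E
   <= ((b - c) `^ (r + 1) / (r + 1))%:E)%E.
Proof.
move=> cb r1.
have r0 : 0 < r + 1 by lra.
(* The denominator starts at 2 so that [d i] stays strictly between [c] and [b]. *)
pose d i := c + (b - c) / i.+2%:R.
pose F i := `[d i, b]%classic : set R.
have cd i : c < d i by rewrite ltrDl divr_gt0// subr_gt0.
have db i : d i < b.
  by rewrite -ltrBrDl ltr_pdivrMr// ltr_pMr ?subr_gt0// ltr1n.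
have FE : \bigcup_i F i = `]c, b]%classic.
  apply/seteqP; split => x /=.
    move=> [i _]; rewrite /F /= !in_itv/= => /andP[dx ->]; rewrite andbT.
    exact: lt_le_trans dx.
  rewrite in_itv/= => /andP[cx xb].
  have [n hn] : exists n : nat, (b - c) / (x - c) < n%:R.
    by exists (Num.bound ((b - c) / (x - c))); apply: archi_boundP; rewrite divr_ge0// subr_ge0 ltW.
  exists n => //; rewrite /F /= in_itv/= xb andbT -lerBrDl.
  rewrite ler_pdivrMr// mulrC -ler_pdivrMr ?subr_gt0//.
  by apply: le_trans (ltW hn) _; rewrite ler_nat; apply: leq_trans (leqnSn _) (leqnSn _).
have cvgI : (\int[lebesgue_measure]_(x in F i) ((x - c) `^ r)%:E @[i --> \oo] -->
    \int[lebesgue_measure]_(x in \bigcup_i F i) ((x - c) `^ r)%:E)%E.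
  apply: ge0_nondecreasing_set_cvg_integral.
  - move=> m n mn; rewrite subsetEset => x; rewrite /F /= !in_itv/= => /andP[dx ->]; rewrite andbT.
    apply: le_trans dx; rewrite /d lerD2l; apply: ler_wpM2l; first by rewrite subr_ge0 ltW.
    by rewrite lef_pV2 ?posrE// ler_nat !ltnS.
  - by move=> i; exact: measurable_itv.
  - move=> i; apply/measurable_EFinP.
    by apply: measurable_funTS; exact: measurable_powR_sub.
  - by move=> i x _; rewrite lee_fin powR_ge0.
rewrite -FE -(cvg_lim _ cvgI) //.
apply: lime_le; first by apply/cvg_ex; eexists; exact: cvgI.
apply: nearW => i.
rewrite (@continuous_FTC2 R _ (fun t => (t - c) `^ (r + 1) / (r + 1)) _ _ (db i)).
- by rewrite -EFinB lee_fin gerBl divr_ge0 ?powR_ge0// ltW.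
- apply: continuous_in_subspaceT => x; rewrite inE/= in_itv/= => /andP[dx _].
  by apply: continuous_powR_shift; apply: lt_le_trans dx.
- split.
  + move=> x; rewrite in_itv/= => /andP[dx _].
    by have [] := is_derive_powR_shift (lt0r_neq0 r0) (lt_trans (cd i) dx).
  + apply: cvg_at_right_filter; apply: cvgMl; exact: continuous_powR_shift.
  + apply: cvg_at_left_filter; apply: cvgMl; exact: continuous_powR_shift.
- move=> x; rewrite in_itv/= => /andP[dx _].
  rewrite derive1E.
  have := is_derive_powR_shift (lt0r_neq0 r0) (lt_trans (cd i) dx) => hx.
  by rewrite derive_val addrK.
Qed.

(* The test [x != y] makes [integral_riesz_slice] hold on the diagonal as well,
   where [0 `^ (s - 1) = 0]. *)
Definition riesz_slice (R : realType) (s : R) (x y u v : R) : R :=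
  if [&& x != y, u < Num.min x y & Num.max x y < v] then (v - u) `^ (s - 3) else 0.

(** With [m] and [M] the smaller and larger of [x] and [y], integrating over [v > M] gives
    [(M - u)^(s-2) / (2-s)], and integrating this over [u < m] gives the factor [1 / (1-s)]; the
    second integral is finite because [s < 1]. *)
Lemma integral_riesz_slice (R : realType) (s x y : R) : s < 1 ->
  (\int[lebesgue_measure]_u \int[lebesgue_measure]_v (riesz_slice s x y u v)%:E
   = (`|x - y| `^ (s - 1) / ((1 - s) * (2 - s)))%:E)%E.
Proof.
move=> s1.
have [<-|xy] := eqVneq x y.
  rewrite subrr normr0 powR0 ?mul0r; last by rewrite subr_eq0 lt_eqF.
  rewrite integral0_eq// => u _; rewrite integral0_eq// => v _.
  by rewrite /riesz_slice eqxx.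
set m := Num.min x y; set M := Num.max x y.
have [mM xyE] : m < M /\ `|x - y| = M - m.
  rewrite /m /M; move: xy; rewrite neq_lt => /orP[] h.
    by rewrite min_l ?max_r ?(ltW h)// distrC gtr0_norm ?subr_gt0.
  by rewrite min_r ?max_l ?(ltW h)// gtr0_norm ?subr_gt0.
have inner u : (\int[lebesgue_measure]_v (riesz_slice s x y u v)%:E
    = if (u < m)%R then ((M - u) `^ (s - 2) / (2 - s))%:E else 0)%E.
  rewrite /= /riesz_slice xy -/m -/M /=.
  have [um|um] := ltP u m; last first.
    by rewrite integral0_eq.
  transitivity (\int[lebesgue_measure]_(v in `]M, +oo[) ((v - u) `^ (s - 3))%:E)%E.
    rewrite [RHS]integral_mkcond; apply: eq_integral => v _; rewrite patchE.
    by rewrite mem_setE in_itv/= andbT; case: ifP.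
  rewrite integral_itv_obnd_cbnd; last first.
    apply/measurable_EFinP.
    by apply: measurable_funTS; exact: measurable_powR_sub.
  rewrite integral_powR_ray; [|exact: lt_trans mM|lra].
  congr (_%:E); have -> : s - 3 + 1 = s - 2 by ring.
  have -> : s - 2 = - (2 - s) by ring.
  by rewrite invrN mulrN opprK.
under eq_integral do rewrite inner.
transitivity (\int[lebesgue_measure]_(u in `]-oo, m[) ((M - u) `^ (s - 2) / (2 - s))%:E)%E.
  rewrite [RHS]integral_mkcond; apply: eq_integral => u _; rewrite patchE.
  by rewrite mem_setE in_itv/=.
have contF (z : R) : z <= m -> {for z, continuous (fun u => (M - u) `^ (s - 2) / (2 - s))}.
  move=> zm; apply: cvgMl.
  have zM : M - z > 0 by rewrite subr_gt0; exact: le_lt_trans mM.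
  apply: (@continuous_comp _ _ _ (fun u => M - u) (@powR R ^~ (s - 2))).
    by apply: cvgB; [exact: cvg_cst|exact: cvg_id].
  have -> : @powR R ^~ (s - 2) = fun t => (t - 0) `^ (s - 2).
    by apply/funext => t; rewrite subr0.
  exact: continuous_powR_shift.
rewrite integral_itv_bndo_bndc; last first.
  apply/measurable_EFinP; apply: measurable_funM => //.
  by apply: measurable_funTS; exact: measurable_powR_sub.
(* The reflection [u -> -u] turns the left ray into a right ray, so that [integral_powR_ray] applies
   with singularity at [- M]. *)
rewrite -{1}(opprK m) ge0_integration_by_substitutionNy.
- rewrite /= .
  under eq_integral do rewrite EFinM.
  rewrite ge0_integralZr//; last 3 first.
  + apply/measurable_EFinP.
    by apply: measurable_funTS; apply: measurable_powR_sub => //; exact: measurable_oppr.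
  + by move=> z _; rewrite lee_fin powR_ge0.
  + by rewrite lee_fin invr_ge0; lra.
  rewrite (eq_integral (fun x : measurableTypeR R => ((x - - M) `^ (s - 2))%:E)); last first.
    by move=> z _; rewrite !opprK addrC.
  rewrite integral_powR_ray; [|by rewrite ltrN2|lra].
  rewrite -EFinM; congr (_%:E).
  rewrite xyE opprK [- m + M]addrC.
  have -> : s - 2 + 1 = s - 1 by ring.
  have -> : (s - 1)^-1 = - (1 - s)^-1 by rewrite -invrN opprB.
  by rewrite mulrN opprK invfM mulrA.
- rewrite opprK; apply: continuous_in_subspaceT => z; rewrite inE/= in_itv/= => zm.
  exact: contF.
- by move=> z _; rewrite divr_ge0 ?powR_ge0//; lra.
Qed.

(** * Fubini's theorem for real-valued integrals *)

Section Rfubini.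
Context d1 d2 (T1 : measurableType d1) (T2 : measurableType d2) (R : realType).
Variables (m1 : {sigma_finite_measure set T1 -> \bar R})
  (m2 : {sigma_finite_measure set T2 -> \bar R}) (f : T1 * T2 -> R).
Hypothesis fint : (m1 \x m2)%E.-integrable setT (EFin \o f).

Lemma abse_fine_le (z : \bar R) : (`|(fine z)%:E| <= `|z|)%E.
Proof. by case: z => [r| |]; rewrite /= ?normr0 ?leey ?lexx. Qed.

Lemma integrable_inner1 : m2.-integrable setT (fun y => \int[m1]_x (f (x, y))%:E)%E.
Proof.
have /integrableP[mf _] := fint.
have mfs : measurable_fun setT ((EFin \o f) \o (fun p : T2 * T1 => (p.2, p.1))).
  apply: measurableT_comp mf _; apply: measurable_fun_pair.
    exact: measurable_snd.
  exact: measurable_fst.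
have /(integrable12ltyP m2 m1 mfs) := (integrable21ltyP m1 m2 mf).1 fint.
exact: integrable_fubini_F.
Qed.

Lemma integrable_Rintegral1 :
  m2.-integrable setT (EFin \o (fun y => \int[m1]_x f (x, y))).
Proof.
have h := integrable_inner1; have /integrableP[mh _] := h.
apply: le_integrable h => //.
  by apply/measurable_EFinP; apply: measurableT_comp mh; exact: fine_measurable.
by move=> y _; apply: abse_fine_le.
Qed.

Lemma integrable_Rintegral2 :
  m1.-integrable setT (EFin \o (fun x => \int[m2]_y f (x, y))).
Proof.
have h := integrable_fubini_F fint; have /integrableP[mh _] := h.
apply: le_integrable h => //.
  by apply/measurable_EFinP; apply: measurableT_comp mh; exact: fine_measurable.
by move=> y _; apply: abse_fine_le.
Qed.

(** The inner integrals are finite only almost everywhere. On the exceptional null set [fine]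
    replaces an infinite value by 0, which the outer integral does not see. *)
Lemma Rintegral_prod1 :
  \int[m2]_y \int[m1]_x f (x, y) = \int[(m1 \x m2)%E]_z f z.
Proof.
congr fine; rewrite -(integral21_prod_meas1 fint).
have h := integrable_inner1; have /integrableP[mh _] := h.
apply: ae_eq_integral => //.
  by have /integrableP[] := integrable_Rintegral1.
have := integrable_ae measurableT h.
by apply: filterS => y hy _; rewrite /Rintegral fineK //; exact: hy.
Qed.

Lemma Rintegral_prod2 :
  \int[m1]_x \int[m2]_y f (x, y) = \int[(m1 \x m2)%E]_z f z.
Proof.
congr fine; rewrite -(integral12_prod_meas1 fint).
have h := integrable_fubini_F fint; have /integrableP[mh _] := h.
apply: ae_eq_integral => //.
  by have /integrableP[] := integrable_Rintegral2.
have := integrable_ae measurableT h.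
by apply: filterS => y hy _; rewrite /Rintegral fineK //; exact: hy.
Qed.
End Rfubini.

(* Named so that it can carry a sigma-finite structure, which is not inferred
   for a product measure and is needed for Fubini on [lebesgue2 \x lebesgue2]. *)
Definition lebesgue2 (R : realType) : set (measurableTypeR R * measurableTypeR R) -> \bar R :=
  (@lebesgue_measure R \x @lebesgue_measure R)%E.
HB.instance Definition _ (R : realType) := Measure.on (@lebesgue2 R).

Lemma lebesgue2_sigma_finite (R : realType) : sigma_finite setT (@lebesgue2 R).
Proof.
have /sigma_finiteP[F [TF ndF Foo]] := sigma_finiteT (@lebesgue_measure R).
(* Squares of one increasing exhaustion suffice: a point whose coordinates lie in [F n] and [F m]
   lies in the square of index [maxn n m]. *)
exists (fun n => F n `*` F n).
  apply/seteqP; split=> [[x y] _|//].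
  have [n _ Fx] : (\bigcup_n F n) x by rewrite -TF.
  have [m _ Fy] : (\bigcup_n F n) y by rewrite -TF.
  by exists (maxn n m) => //; split => /=;
    [move: x Fx|move: y Fy]; apply/subsetPset/ndF; rewrite ?leq_maxl ?leq_maxr.
move=> k; have [mF Fk] := Foo k.
split; first exact: measurableX.
by rewrite /lebesgue2 product_measure1E// lte_mul_pinfty// ge0_fin_numE.
Qed.
HB.instance Definition _ (R : realType) :=
  Measure_isSigmaFinite.Build _ _ _ (@lebesgue2 R) (@lebesgue2_sigma_finite R).

(** * The Riesz kernel against bounded functions of bounded support *)

Section Riesz.
Variable R : realType.
Notation lam := (@lebesgue_measure R).
Notation lam2 := (@lebesgue2 R).
Notation RR := (measurableTypeR R * measurableTypeR R)%type.

(** One half of the Riesz kernel truncated to a square. Cutting along the diagonal puts the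
    singularity of each slice at the left end of an interval, as in [le_integral_powR_sing]. *)
Definition upper_riesz (r N : R) (p : RR) : R :=
  if [&& `|p.1| <= N, `|p.2| <= N & p.2 < p.1] then (p.1 - p.2) `^ r else 0.

Lemma measurable_upper_riesz r N : measurable_fun setT (upper_riesz r N).
Proof.
apply: measurable_fun_ifT.
- apply: measurable_and; last apply: measurable_and.
  + apply: measurable_fun_ler => //; apply: measurableT_comp => //; exact: measurable_fst.
  + apply: measurable_fun_ler => //; apply: measurableT_comp => //; exact: measurable_snd.
  + by apply: measurable_fun_ltr; [exact: measurable_snd|exact: measurable_fst].
- by apply: measurable_powR_sub; [exact: measurable_fst|exact: measurable_snd].
- exact: measurable_cst.
Qed.

Lemma upper_riesz_ge0 r N p : 0 <= upper_riesz r N p.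
Proof. by rewrite /upper_riesz; case: ifP => // _; apply: powR_ge0. Qed.

Lemma integral_upper_riesz_le r N y : -1 < r -> 0 < N ->
  (\int[lam]_x (upper_riesz r N (x, y))%:E <=
    if (`|y| <= N)%R then ((2 * N) `^ (r + 1) / (r + 1))%:E else 0)%E.
Proof.
move=> r1 N0; case: ifPn => yN; last first.
  by rewrite integral0_eq// => x _; rewrite /upper_riesz/= (negbTE yN) andbF.
(* Two points of [[-N, N]] are at most [2 * N] apart, so every slice fits into []y, b]], whose
   length does not depend on [y]. *)
pose b := y + 2 * N.
apply: (@le_trans _ _ (\int[lam]_(x in `]y, b]) ((x - y) `^ r)%:E)%E).
  rewrite [leRHS]integral_mkcond; apply: ge0_le_integral => //.
  - by move=> x _; rewrite lee_fin upper_riesz_ge0.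
  - apply/measurable_EFinP.
    by apply: (measurable_fun_pair1 y (measurable_upper_riesz r N)).
  - apply/(measurable_restrictT _ _).1 => //.
    apply/measurable_EFinP/measurable_funTS.
    by apply: measurable_powR_sub.
  move=> x _; rewrite patchE mem_setE in_itv/= /upper_riesz/= yN/=.
  case: (ltP y x) => [yx|_]; rewrite /= ?andbF ?andbT//.
  case: (leP `|x| N) => xN; last by case: ifP => // _; rewrite lee_fin powR_ge0.
  rewrite ifT// /b; move: xN yN; rewrite !ler_norml => /andP[_ ?] /andP[? _]; lra.
have := @le_integral_powR_sing R y b r.
by rewrite /b [y + _ - y]addrC addKr; apply => //; rewrite ltrDl; lra.
Qed.

Lemma integrable_upper_riesz r N : -1 < r -> 0 < N ->
  lam2.-integrable setT (EFin \o upper_riesz r N).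
Proof.
move=> r1 N0; apply/integrable21ltyP.
by apply/measurable_EFinP; exact: measurable_upper_riesz.
set K := (2 * N) `^ (r + 1) / (r + 1).
apply: (@le_lt_trans _ _ (\int[lam]_(y in `[(- N)%R, N]) (K%:E))%E); last first.
  by rewrite integral_cst//= lebesgue_measure_itv/=; case: ifP => _; rewrite ltry.
rewrite [leRHS]integral_mkcond; apply: ge0_le_integral => //.
- by move=> y _; apply: integral_ge0.
- apply: (@measurable_fun_fubini_tonelli_G _ _ _ _ R lam
    (fun p => `|(EFin \o upper_riesz r N) p|)%E).
    apply: measurableT_comp => //; by apply/measurable_EFinP; exact: measurable_upper_riesz.
  by [].
- by apply/(measurable_restrictT _ _).1 => //.
- move=> y _; rewrite patchE mem_setE in_itv/= -ler_norml.
  have := @integral_upper_riesz_le r N y r1 N0.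
  under eq_integral => x _.
    rewrite -[(upper_riesz _ _ _)%:E]gee0_abs ?lee_fin ?upper_riesz_ge0//.
    over.
  by [].
Qed.

Implicit Types (f g a b : R -> R) (N s e : R) (q : RR).

(** A single constant bounds both the support and the values, so that two functions can be given a
    common one by taking a maximum. *)
Definition bounded_support N f := [/\ 0 < N, measurable_fun setT f &
  forall x, `|f x| <= if `|x| <= N then N else 0].

Lemma bounded_supportW N N' f : N <= N' -> bounded_support N f -> bounded_support N' f.
Proof.
move=> NN' [N0 mf fN]; split => //; first exact: lt_le_trans NN'.
move=> x; apply: le_trans (fN x) _; case: ifPn => xN.
  by rewrite (le_trans xN).
by case: ifP => // _; apply: le_trans NN'; apply: ltW.
Qed.

Lemma measurable_dist_powR r : measurable_fun setT (fun p : RR => `|p.1 - p.2| `^ r).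
Proof.
have -> : (fun p : RR => `|p.1 - p.2| `^ r) =
  (@powR R ^~ r) \o (fun p : RR => `|p.1 - p.2|) by [].
apply: measurableT_comp => //; apply: measurableT_comp => //.
by apply: measurable_funB; [exact: measurable_fst|exact: measurable_snd].
Qed.

Lemma integrable_swap (h : RR -> \bar R) : lam2.-integrable setT h ->
  lam2.-integrable setT (h \o (fun p : RR => (p.2, p.1))).
Proof.
move=> hint; have /integrableP[mh _] := hint.
apply/(integrable12ltyP lam lam).
  apply: measurableT_comp mh _; apply: measurable_fun_pair.
    exact: measurable_snd.
  exact: measurable_fst.
exact: (integrable21ltyP lam lam mh).1.
Qed.

Lemma integrable_riesz s N f g : 0 < s -> s < 1 -> bounded_support N f -> bounded_support N g ->
  lam2.-integrable setT (EFin \o (fun p : RR => f p.1 * `|p.1 - p.2| `^ (s - 1) * g p.2)).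
Proof.
move=> s0 s1' [N0 mf fN] [_ mg gN].
have s1 : - 1 < s - 1 by lra.
have iu := integrable_upper_riesz s1 N0.
have iv := integrable_swap iu.
(* Off the diagonal, the half kernel and its mirror image add up to the full kernel on the square;
   [N * N] bounds the product of the two functions. *)
have iuv := integrableZl measurableT (N * N) (integrableD measurableT iu iv).
apply: le_integrable iuv => //.
  apply/measurable_EFinP; apply: measurable_funM; first apply: measurable_funM.
  - by apply: measurableT_comp => //; exact: measurable_fst.
  - exact: measurable_dist_powR.
  - by apply: measurableT_comp => //; exact: measurable_snd.
move=> [x y] _; rewrite /= lee_fin !normrM.
rewrite (ger0_norm (powR_ge0 _ _)) (@ger0_norm _ (upper_riesz _ _ _ + _)); last first.
  by rewrite addr_ge0 ?upper_riesz_ge0.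
rewrite (gtr0_norm N0).
rewrite mulrAC.
(* On the diagonal the kernel is [0 ^ (s-1)], which is 0 by convention. *)
have [xy|xy] := eqVneq x y.
  rewrite xy subrr normr0 powR0 ?mulr0; last by rewrite subr_eq0 lt_eqF.
  by rewrite !mulr_ge0 ?addr_ge0 ?upper_riesz_ge0// ltW.
have := fN x; have := gN y; rewrite /upper_riesz/=.
case: (leP `|x| N) => xN; last first.
  by rewrite [`|f x| <= _]normr_le0 => _ /eqP ->; rewrite normr0 !mul0r andbF addr0 mulr0.
case: (leP `|y| N) => yN; last first.
  by rewrite normr_le0 => /eqP -> _; rewrite normr0 mulr0 mul0r andbF addr0 mulr0.
move=> gy fx /=.
have -> : (if y < x then (x - y) `^ (s - 1) else 0) +
    (if x < y then (y - x) `^ (s - 1) else 0) = `|x - y| `^ (s - 1).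
  move: xy; rewrite neq_lt => /orP[] h.
    by rewrite h ltNge (ltW h) /= add0r distrC gtr0_norm ?subr_gt0.
  by rewrite h ltNge (ltW h) /= addr0 gtr0_norm ?subr_gt0.
by apply: ler_wpM2r; [exact: powR_ge0|exact: ler_pM].
Qed.

(** * The Riesz form as a weighted L^2 product of increments *)

Lemma diag_negligible : lam2.-negligible [set p : RR | p.1 = p.2].
Proof.
have mD : measurable [set p : RR | p.1 = p.2].
  have := @measurable_fun_eqr _ _ _ setT (@fst R R : RR -> R) (@snd R R : RR -> R)
    measurable_fst measurable_snd.
  move=> /(_ measurableT [set true] I); rewrite setTI.
  by congr measurable; apply/seteqP; split => p /= /eqP.
apply/negligibleP => //.
rewrite [LHS](_ : _ = \int[lam]_x (lam \o xsection [set p : RR | p.1 = p.2]) x)%E//.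
rewrite integral0_eq// => x _ /=.
rewrite (_ : xsection _ _ = [set x]) ?lebesgue_measure_set1//.
by apply/seteqP; split => y /=; rewrite /xsection/= inE.
Qed.

Lemma measurable_riesz_slice s : measurable_fun setT
  (fun z : (RR * RR)%type => riesz_slice s z.1.1 z.1.2 z.2.1 z.2.2).
Proof.
have m1 := @measurable_fst _ _ RR RR.
have m2 := @measurable_snd _ _ RR RR.
have m11 : measurable_fun setT (fun z : (RR * RR)%type => z.1.1).
  by apply: measurableT_comp m1; exact: measurable_fst.
have m12 : measurable_fun setT (fun z : (RR * RR)%type => z.1.2).
  by apply: measurableT_comp m1; exact: measurable_snd.
have m21 : measurable_fun setT (fun z : (RR * RR)%type => z.2.1).
  by apply: measurableT_comp m2; exact: measurable_fst.
have m22 : measurable_fun setT (fun z : (RR * RR)%type => z.2.2).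
  by apply: measurableT_comp m2; exact: measurable_snd.
apply: measurable_fun_ifT.
- apply: measurable_and; last apply: measurable_and.
  + by apply: measurable_neg; apply: measurable_fun_eqr.
  + apply: measurable_fun_ltr => //; exact: measurable_minr.
  + apply: measurable_fun_ltr => //; exact: measurable_maxr.
- exact: measurable_powR_sub.
- exact: measurable_cst.
Qed.

Lemma riesz_slice_ge0 s (x y u v : R) : 0 <= riesz_slice s x y u v.
Proof. by rewrite /riesz_slice; case: ifP => // _; apply: powR_ge0. Qed.

Lemma integral2_riesz_slice s (p : RR) : s < 1 ->
  (\int[lam2]_q (riesz_slice s p.1 p.2 q.1 q.2)%:E
   = (`|p.1 - p.2| `^ (s - 1) / ((1 - s) * (2 - s)))%:E)%E.
Proof.
move=> s1; rewrite fubini_tonelli1/=.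
- by rewrite /fubini_F /=; exact: integral_riesz_slice.
- apply/measurable_EFinP.
  exact: (measurable_fun_pair2 p (measurable_riesz_slice s)).
- by move=> q; rewrite lee_fin riesz_slice_ge0.
Qed.

Lemma integrable_riesz_slice2 s (p : RR) : s < 1 ->
  lam2.-integrable setT (fun q : RR => (riesz_slice s p.1 p.2 q.1 q.2)%:E).
Proof.
move=> s1; apply/integrableP; split.
  apply/measurable_EFinP.
  exact: (measurable_fun_pair2 p (measurable_riesz_slice s)).
under eq_integral => q _ do rewrite gee0_abs ?lee_fin ?riesz_slice_ge0//.
by rewrite integral2_riesz_slice// ltry.
Qed.

(** By Tonelli the absolute value may be integrated over the slicing variables first. This restores
    the Riesz kernel up to a constant and reduces the claim to [integrable_riesz]. *)
Lemma integrable_riesz_slice s N f g : 0 < s -> s < 1 ->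
  bounded_support N f -> bounded_support N g ->
  (lam2 \x lam2)%E.-integrable setT (EFin \o (fun z : (RR * RR)%type =>
     f z.1.1 * g z.1.2 * riesz_slice s z.1.1 z.1.2 z.2.1 z.2.2)).
Proof.
move=> s0 s1 bf bg.
have [N0 mf _] := bf; have [_ mg _] := bg.
have C0 : 0 < (1 - s) * (2 - s) by apply: mulr_gt0; lra.
apply/(integrable12ltyP lam2 lam2).
  apply/measurable_EFinP; apply: measurable_funM; last exact: measurable_riesz_slice.
  have m1 := @measurable_fst _ _ RR RR.
  apply: measurable_funM.
    apply: measurableT_comp mf _.
    by apply: measurableT_comp m1; exact: measurable_fst.
  apply: measurableT_comp mg _.
  by apply: measurableT_comp m1; exact: measurable_snd.
have /(integrableZl measurableT ((1 - s) * (2 - s))^-1) /integrableP[_] :=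
  integrable_riesz s0 s1 bf bg.
apply: le_lt_trans; rewrite le_eqVlt; apply/orP; left; apply/eqP.
apply: eq_integral => p _ /=.
under eq_integral => q _ do rewrite normrM EFinM (ger0_norm (riesz_slice_ge0 _ _ _ _ _)).
rewrite ge0_integralZl//=.
- rewrite integral2_riesz_slice// -EFinM; congr (_%:E).
  rewrite !normrM (ger0_norm (powR_ge0 _ _)) (@gtr0_norm _ _^-1) ?invr_gt0//.
  by set c := (_ * _)^-1; ring.
- apply/measurable_EFinP.
  exact: (measurable_fun_pair2 p (measurable_riesz_slice s)).
- by move=> q; rewrite lee_fin riesz_slice_ge0.
Qed.

Lemma bounded_support_integrable N f : bounded_support N f ->
  lam.-integrable setT (EFin \o f).
Proof.
move=> [N0 mf fN]; apply/integrableP; split; first exact/measurable_EFinP.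
apply: (@le_lt_trans _ _ (\int[lam]_(y in `[(- N)%R, N]) (N%:E))%E); last first.
  by rewrite integral_cst//= lebesgue_measure_itv/=; case: ifP => _; rewrite ltry.
rewrite [leRHS]integral_mkcond; apply: ge0_le_integral => //.
- by apply: measurableT_comp => //; exact/measurable_EFinP.
- by apply/(measurable_restrictT _ _).1 => //.
- move=> y _; rewrite patchE mem_setE in_itv/= -ler_norml.
  by have := fN y; case: ifP.
Qed.

Lemma integrable_prodM a b : lam.-integrable setT (EFin \o a) ->
  lam.-integrable setT (EFin \o b) ->
  lam2.-integrable setT (EFin \o (fun p : RR => a p.1 * b p.2)).
Proof.
move=> ia ib.
have /integrableP[/measurable_EFinP ma aoo] := ia.
have /integrableP[/measurable_EFinP mb boo] := ib.
apply/(integrable21ltyP lam lam).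
  apply/measurable_EFinP; apply: measurable_funM.
    by apply: measurableT_comp => //; exact: measurable_fst.
  by apply: measurableT_comp => //; exact: measurable_snd.
under eq_integral => y _.
  under eq_integral => x _ do rewrite /= normrM EFinM.
  rewrite ge0_integralZr//; last first.
    by apply/measurable_EFinP; apply: measurableT_comp.
  over.
rewrite ge0_integralZl//; last 2 first.
  by apply/measurable_EFinP; apply: measurableT_comp.
  by apply: integral_ge0.
apply: lte_mul_pinfty => //; first exact: integral_ge0.
by rewrite ge0_fin_numE//; exact: integral_ge0.
Qed.

Lemma Rintegral_prodM a b : lam.-integrable setT (EFin \o a) ->
  lam.-integrable setT (EFin \o b) ->
  \int[lam2]_p (a p.1 * b p.2) = (\int[lam]_x a x) * (\int[lam]_y b y).
Proof.
move=> ia ib.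
have := @Rintegral_prod1 _ _ _ _ R lam lam _ (integrable_prodM ia ib).
move=> <- /=.
under eq_Rintegral => y _ do rewrite RintegralZr//.
by rewrite RintegralZl.
Qed.

(** For [q.2 <= q.1] the interval is empty and the value is 0, so integrals over the whole plane
    involving [incr] only see the half plane [u < v]. *)
Definition incr f (q : RR) : R := \int[lam]_(x in `]q.1, q.2[) f x.

(** Off the diagonal, the condition [u < min] and [max < v] says that both points lie in []u, v[].
    The integrand is then a product of a function of [p.1] and a function of [p.2], and the double
    integral factors. *)
Lemma Rintegral_riesz_slice s N f g (q : RR) :
  bounded_support N f -> bounded_support N g ->
  \int[lam2]_p (f p.1 * g p.2 * riesz_slice s p.1 p.2 q.1 q.2) =
  (q.2 - q.1) `^ (s - 3) * incr f q * incr g q.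
Proof.
move=> bf bg.
have [_ mf _] := bf. have [_ mg _] := bg.
have res h : lam.-integrable setT (EFin \o h) ->
    lam.-integrable setT (EFin \o (h \_ `]q.1, q.2[)).
  move=> ih; rewrite -restrict_EFin; apply/integrable_restrict => //.
  by rewrite setTI; apply: integrableS ih.
have ia := res _ (bounded_support_integrable bf).
have ib := res _ (bounded_support_integrable bg).
have iE h : incr h q = \int[lam]_x (h \_ `]q.1, q.2[) x by rewrite /incr Rintegral_mkcond.
rewrite !iE -mulrA -Rintegral_prodM//.
rewrite -RintegralZl//; last exact: integrable_prodM.
congr fine; apply: ae_eq_integral => //.
- apply/measurable_EFinP; apply: measurable_funM; first apply: measurable_funM.
  + by apply: measurableT_comp => //; exact: measurable_fst.
  + by apply: measurableT_comp => //; exact: measurable_snd.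
  + by apply: (measurable_fun_pair1 q (measurable_riesz_slice s)).
- apply/measurable_EFinP; apply: measurable_funM => //.
  by have /integrableP[/measurable_EFinP] := integrable_prodM ia ib.
apply: (negligibleS _ diag_negligible) => p /=.
apply: contra_notP => /eqP xy _.
rewrite !patchE !mem_setE !in_itv/= /riesz_slice xy/= lt_min gt_max.
case: (q.1 < p.1); rewrite /= ?mul0r ?mulr0//.
case: (q.1 < p.2); rewrite /= ?mul0r ?mulr0 ?andbF//=.
case: (p.1 < q.2); rewrite /= ?mul0r ?mulr0 ?andbF//=.
case: (p.2 < q.2); rewrite /= ?mul0r ?mulr0 ?andbF//=.
by rewrite [in RHS]mulrC.
Qed.

Definition rriesz s f g := \int[lam]_y \int[lam]_x (f x * `|x - y| `^ (s - 1) * g y).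

Lemma integrable_incr s N f g : 0 < s -> s < 1 ->
  bounded_support N f -> bounded_support N g ->
  lam2.-integrable setT
    (EFin \o (fun q : RR => (q.2 - q.1) `^ (s - 3) * incr f q * incr g q)).
Proof.
move=> s0 s1 bf bg.
have := integrable_Rintegral1 (integrable_riesz_slice s0 s1 bf bg).
apply: eq_integrable => // q _ /=; congr (_%:E).
exact: Rintegral_riesz_slice bf bg.
Qed.

(** The kernel is written as an integral of slices and the two double integrals are exchanged. For
    [f = g] the new integrand is visibly nonnegative. *)
Lemma rriesz_incr s N f g : 0 < s -> s < 1 ->
  bounded_support N f -> bounded_support N g ->
  rriesz s f g = (1 - s) * (2 - s) *
    \int[lam2]_q ((q.2 - q.1) `^ (s - 3) * incr f q * incr g q).
Proof.
move=> s0 s1 bf bg.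
have C0 : 0 < (1 - s) * (2 - s) by apply: mulr_gt0; lra.
have i2 := integrable_riesz s0 s1 bf bg.
have i4 := integrable_riesz_slice s0 s1 bf bg.
rewrite /rriesz (@Rintegral_prod1 _ _ _ _ R lam lam _ i2).
transitivity ((1 - s) * (2 - s) * \int[lam2]_p \int[lam2]_q
  (f p.1 * g p.2 * riesz_slice s p.1 p.2 q.1 q.2)).
  have ii := integrable_Rintegral2 i4.
  rewrite -RintegralZl//; apply: eq_Rintegral => p _ /=.
  rewrite /Rintegral.
  under eq_integral => q _ do rewrite EFinM.
  rewrite integralZl//; last exact: integrable_riesz_slice2.
  rewrite integral2_riesz_slice//=.
  field; lra.
rewrite (Rintegral_prod2 i4) -(Rintegral_prod1 i4); congr (_ * _).
by apply: eq_Rintegral => q _; exact: Rintegral_riesz_slice bf bg.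
Qed.

Definition bsupp f := exists N, bounded_support N f.

Lemma bsupp2 f g : bsupp f -> bsupp g ->
  exists N, bounded_support N f /\ bounded_support N g.
Proof.
move=> [N fN] [N' gN']; exists (Num.max N N'); split.
  by apply: bounded_supportW fN; rewrite le_max lexx.
by apply: bounded_supportW gN'; rewrite le_max lexx orbT.
Qed.

(** * Functions concentrating at the origin *)

Lemma incr_eq0 f e q : (forall x, e <= `|x| -> f x = 0) ->
  [|| e <= q.1, q.2 <= - e | q.2 <= q.1] -> incr f q = 0.
Proof.
move=> f0 h; rewrite /incr (@eq_Rintegral _ _ _ _ _ (cst 0)).
  by rewrite Rintegral_cst//= mul0r.
move=> x; rewrite inE/= in_itv/= => /andP[ux xv]; apply: f0.
rewrite ler_normr; case/or3P: h => h; apply/orP; [left|right|left]; lra.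
Qed.

Lemma incr_full f e q : (forall x, e <= `|x| -> f x = 0) ->
  q.1 <= - e -> e <= q.2 -> incr f q = \int[lam]_x f x.
Proof.
move=> f0 h1 h2; rewrite /incr Rintegral_mkcond; apply: eq_Rintegral => x _.
rewrite patchE mem_setE in_itv/=; case: ifPn => //.
rewrite negb_and -!leNgt => h; apply/esym/f0; rewrite ler_normr.
by case/orP: h => h; apply/orP; [right|left]; lra.
Qed.

(** The integrand of [rriesz_incr] is nonnegative, and for [u < -e], [e < v] both increments equal
    the full mass. The weight restricted to that region is the slice of the pair [e], [- e], whose
    integral is already known. *)
Lemma mass_le_rriesz s e f : 0 < s -> s < 1 -> 0 < e -> bsupp f ->
  (forall x, e <= `|x| -> f x = 0) ->
  (\int[lam]_x f x) ^+ 2 * (2 * e) `^ (s - 1) <= rriesz s f f.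
Proof.
move=> s0 s1 e0 [N bf] f0.
have C0 : 0 < (1 - s) * (2 - s) by apply: mulr_gt0; lra.
rewrite (rriesz_incr s0 s1 bf bf) -ler_pdivrMl//.
set m := \int[lam]_x f x.
have i1 := integrable_riesz_slice2 ((e, - e) : RR) s1.
have -> : ((1 - s) * (2 - s))^-1 * (m ^+ 2 * (2 * e) `^ (s - 1)) =
    \int[lam2]_q (m ^+ 2 * riesz_slice s e (- e) q.1 q.2).
  rewrite RintegralZl// mulrCA; congr (_ * _).
  rewrite /Rintegral (integral2_riesz_slice ((e, - e) : RR) s1)/= opprK mulrC.
  by congr (_ `^ _ / _); rewrite gtr0_norm; lra.
apply: le_Rintegral => //.
- have := integrableZl measurableT (m ^+ 2) i1.
  by apply: eq_integrable.
- exact: (integrable_incr s0 s1 bf bf).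
- move=> q _ /=; rewrite /riesz_slice; case: ifPn => h; last first.
    by rewrite mulr0 -mulrA mulr_ge0 ?powR_ge0// -expr2 sqr_ge0.
  move: h => /and3P[_]; rewrite lt_min gt_max => /andP[_ h1] /andP[h2 _].
  by rewrite (incr_full f0 (ltW h1) (ltW h2)) mulrC expr2 mulrA.
Qed.

Lemma axes_negligible : lam2.-negligible [set q : RR | q.1 = 0 \/ q.2 = 0].
Proof.
have -> : [set q : RR | q.1 = 0 \/ q.2 = 0] = ([set 0] `*` setT) `|` (setT `*` [set 0]).
  apply/seteqP; split => [[u v] /= [->|->]|[u v] /= [[-> _]|[_ ->]]];
    by [left|right].
have m0 : measurable ([set 0] : set (measurableTypeR R)) by exact: measurable_set1.
have mT : measurable (setT : set (measurableTypeR R)) by exact: measurableT.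
have E (A B : set (measurableTypeR R)) : measurable A -> measurable B ->
    lam2 (A `*` B) = (lam A * lam B)%E by exact: product_measure1E.
apply: negligibleU; (apply/negligibleP; first exact: measurableX).
  by rewrite [LHS](E _ _ m0 mT) lebesgue_measure_set1 mul0e.
by rewrite [LHS](E _ _ mT m0) lebesgue_measure_set1 mule0.
Qed.

Lemma mass_cvg0 s (f_ : nat -> R -> R) (e_ : nat -> R) M : 0 < s -> s < 1 ->
  (forall n, bsupp (f_ n)) -> (forall n, 0 < e_ n) -> e_ n @[n --> \oo] --> 0 ->
  (forall n x, e_ n <= `|x| -> f_ n x = 0) ->
  (forall n, rriesz s (f_ n) (f_ n) <= M) ->
  \int[lam]_x f_ n x @[n --> \oo] --> 0.
Proof.
move=> s0 s1 bf e0 ecvg f0 fM.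
have M0 : 0 <= M.
  apply: le_trans (fM 0%N); apply: le_trans (mass_le_rriesz s0 s1 (e0 0%N) (bf 0%N) (f0 0%N)).
  by rewrite mulr_ge0 ?powR_ge0// sqr_ge0.
apply/cvgrPdist_lt => d d0.
(* Chosen so that [(2 * dd)^(1-s) = d^2 / (M + 1)]; the summand 1 keeps the denominator positive
   when [M = 0]. *)
pose dd := (d ^+ 2 / (M + 1)) `^ ((1 - s)^-1) / 2.
have dd0 : 0 < dd.
  by rewrite divr_gt0// powR_gt0// divr_gt0 ?exprn_gt0//; lra.
have /cvgrPdist_lt /(_ dd dd0) := ecvg.
apply: filterS => n; rewrite sub0r normrN gtr0_norm// => en.
rewrite sub0r normrN -(ltr_pXn2r (n := 2))// ?nnegrE ?ltW//.
rewrite real_normK ?num_real//.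
have h := le_trans (mass_le_rriesz s0 s1 (e0 n) (bf n) (f0 n)) (fM n).
set m := \int[lam]_x f_ n x in h *.
have en2 : 0 < 2 * e_ n by have := e0 n; lra.
have pp : 0 < (2 * e_ n) `^ (1 - s) by apply: powR_gt0.
have h2 : m ^+ 2 <= M * (2 * e_ n) `^ (1 - s).
  rewrite -ler_pdivrMr// -powRN; by rewrite opprB.
apply: le_lt_trans h2 _.
have h3 : (2 * e_ n) `^ (1 - s) < d ^+ 2 / (M + 1).
  have s10 : 0 < 1 - s by lra.
  have -> : d ^+ 2 / (M + 1) = (2 * dd) `^ (1 - s).
    rewrite /dd mulrCA divff// mulr1 -powRrM mulVf ?gt_eqF// powRr1//.
    by rewrite divr_ge0 ?sqr_ge0//; lra.
  apply: gt0_ltr_powR => //; rewrite ?nnegrE; [lra|lra|].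
  by rewrite ltr_pM2l.
apply: le_lt_trans (_ : (M + 1) * (2 * e_ n) `^ (1 - s) < _).
  by apply: ler_wpM2r; [exact: ltW|lra].
by rewrite mulrC -ltr_pdivlMr//; lra.
Qed.

(** If 0 lies strictly between [u] and [v], the interval eventually contains the support and the
    increment is the mass. Otherwise, away from the axes, it eventually misses the support and the
    increment vanishes. *)
Lemma incr_cvg0 (f_ : nat -> R -> R) (e_ : nat -> R) q :
  e_ n @[n --> \oo] --> 0 ->
  (forall n x, e_ n <= `|x| -> f_ n x = 0) ->
  \int[lam]_x f_ n x @[n --> \oo] --> 0 ->
  q.1 != 0 -> q.2 != 0 -> incr (f_ n) q @[n --> \oo] --> 0.
Proof.
move=> ecvg f0 mcvg q1 q2.
have small d : 0 < d -> \forall n \near \oo, e_ n <= d.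
  move=> d0; have /cvgrPdist_le /(_ d d0) := ecvg.
  by apply: filterS => n; rewrite sub0r normrN; apply: le_trans; exact: ler_norm.
have [h|h] := boolP [|| 0 < q.1, q.2 < 0 | q.2 <= q.1].
  apply: (@cvg_trans _ (0 @[n --> \oo])); last exact: cvg_cst.
  apply: near_eq_cvg.
  case/or3P: h => h.
  - by have := small _ h; apply: filterS => n hn; rewrite (incr_eq0 (f0 n))// hn.
  - have h' : 0 < - q.2 by lra.
    have := small _ h'; apply: filterS => n hn; rewrite (incr_eq0 (f0 n))//.
    by apply/or3P; apply: Or32; lra.
  - by apply: nearW => n; rewrite (incr_eq0 (f0 n))// h !orbT.
move: h; rewrite !negb_or -!leNgt -ltNge => /and3P[h1 h2 _].
have {}h1 : 0 < - q.1 by rewrite oppr_gt0 lt_neqAle q1.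
have {}h2 : 0 < q.2 by rewrite lt_neqAle eq_sym q2.
apply: cvg_trans mcvg; apply: near_eq_cvg.
have := small _ h1; have := small _ h2.
apply: filterS2 => n hn hm; rewrite (incr_full (f0 n))//; lra.
Qed.

Lemma rriesz_cvg0 s (f_ : nat -> R -> R) g (e_ : nat -> R) M : 0 < s -> s < 1 ->
  (forall n, bsupp (f_ n)) -> bsupp g ->
  (forall n, 0 < e_ n) -> e_ n @[n --> \oo] --> 0 ->
  (forall n x, e_ n <= `|x| -> f_ n x = 0) ->
  (forall n, rriesz s (f_ n) (f_ n) <= M) ->
  rriesz s (f_ n) g @[n --> \oo] --> 0.
Proof.
move=> s0 s1 bf bg e0 ecvg f0 fM.
have mcvg := mass_cvg0 s0 s1 bf e0 ecvg f0 fM.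
have C0 : 0 < (1 - s) * (2 - s) by apply: mulr_gt0; lra.
pose w q := (q.2 - q.1) `^ (s - 3).
(* [A n], [B] and [P n] are the increment integrands of [(f_n, f_n)], [(g, g)] and [(f_n, g)]. *)
pose A n q := w q * incr (f_ n) q * incr (f_ n) q.
pose B q := w q * incr g q * incr g q.
pose P n q := w q * incr (f_ n) q * incr g q.
have w0 q : 0 <= w q by apply: powR_ge0.
have iA n : lam2.-integrable setT (EFin \o A n).
  by have [N fN] := bf n; apply: (integrable_incr s0 s1 fN fN).
have iB : lam2.-integrable setT (EFin \o B).
  by have [N gN] := bg; apply: (integrable_incr s0 s1 gN gN).
have iP n : lam2.-integrable setT (EFin \o P n).
  by have [N [fN gN]] := bsupp2 (bf n) bg; apply: (integrable_incr s0 s1 fN gN).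
have QP n : rriesz s (f_ n) g = (1 - s) * (2 - s) * \int[lam2]_q P n q.
  by have [N [fN gN]] := bsupp2 (bf n) bg; rewrite (rriesz_incr s0 s1 fN gN).
have QA n : (1 - s) * (2 - s) * \int[lam2]_q A n q <= M.
  by have [N fN] := bf n; have := fM n; rewrite (rriesz_incr s0 s1 fN fN).
have mB : measurable_fun setT B by have /integrableP[/measurable_EFinP] := iB.
have mP n : measurable_fun setT (P n) by have /integrableP[/measurable_EFinP] := iP n.
have M0 : 0 <= M.
  apply: le_trans (QA 0%N); apply: mulr_ge0; first exact: ltW.
  apply: Rintegral_ge0 => q _.
  by rewrite /A -mulrA mulr_ge0// -expr2 sqr_ge0.
have B0 q : 0 <= B q by rewrite /B -mulrA mulr_ge0// -expr2 sqr_ge0.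
(* [`|P| <= min `|P| (L B) + A / L] since [`|P| ^ 2 = A B]; the first term is
   dominated by [L B], and the integral of the second is at most [M / L]. *)
pose F (L : R) n q : R := Num.min `|P n q| (L * B q).
have F0 L n q : 0 <= L -> 0 <= F L n q.
  by move=> L0; rewrite le_min normr_ge0 mulr_ge0.
have mF L n : measurable_fun setT (F L n).
  apply: measurable_minr; first exact: measurableT_comp.
  by apply: measurable_funM.
have iLB L : lam2.-integrable setT (EFin \o (fun q => L * B q)).
  by have := integrableZl measurableT L iB; apply: eq_integrable.
have iF L n : 0 <= L -> lam2.-integrable setT (EFin \o F L n).
  move=> L0; apply: le_integrable (iLB L) => //; first exact/measurable_EFinP.
  move=> q _; rewrite /= lee_fin ger0_norm ?F0// (ger0_norm (mulr_ge0 L0 (B0 q))).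
  by rewrite ge_min lexx orbT.
have Fcvg : forall L : R, 0 <= L -> (fun n => \int[lam2]_q F L n q) @ \oo --> (0 : R).
  move=> L L0.
  have [||||| _ _ h] := @dominated_convergence _ _ R lam2 setT measurableT
    (fun n q => (F L n q)%:E) (cst 0%E) (EFin \o (fun q => L * B q)).
  - by move=> n; apply/measurable_EFinP.
  - exact: measurable_cst.
  - apply: (negligibleS _ axes_negligible) => q /=.
    apply: contra_notP => /not_orP[/eqP q1 /eqP q2] _.
    apply: cvg_EFin; first exact: nearW.
    have Pcvg : `|P n q| @[n --> \oo] --> 0.
      rewrite -(@normr0 _ R); apply: cvg_norm.
      rewrite -(mul0r (incr g q)) -(mulr0 (w q)); apply: cvgMl; apply: cvgMr.
      exact: incr_cvg0 ecvg f0 mcvg q1 q2.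
    apply: (@squeeze_cvgr _ _ _ _ (fun=> 0) (fun n => `|P n q|)) => //; last exact: cvg_cst.
    by apply: nearW => n; rewrite F0// ge_min lexx.
  - exact: iLB.
  - apply: aeW => q n _; rewrite /= lee_fin ger0_norm ?F0//.
    by rewrite ge_min lexx orbT.
  by move: h; rewrite integral0; exact: (@fine_cvg R _ \oo _ _ (0 : R)).
apply/cvgrPdist_le => d d0.
(* With this [L] the remainder is at most [M / L <= d / 2]; the truncated part receives the other
   half of [d], divided by the constant [C] in front of the integral. *)
pose L := 2 * (M + 1) / d.
have L0 : 0 < L by rewrite divr_gt0//; lra.
pose C := (1 - s) * (2 - s).
have d2 : 0 < d / 2 / C by rewrite !divr_gt0.
have /cvgrPdist_le /(_ _ d2) := Fcvg L (ltW L0).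
apply: filterS => n; rewrite !sub0r !normrN ger0_norm; last first.
  by apply: Rintegral_ge0 => q _; apply/F0/ltW.
move=> hF.
rewrite QP -/C normrM gtr0_norm//.
have h1 : `|\int[lam2]_q P n q| <= \int[lam2]_q (F L n q + L^-1 * A n q).
  apply: le_trans (le_normr_Rintegral _ _) _ => //.
  have iLA : lam2.-integrable setT (EFin \o (fun q => L^-1 * A n q)).
    by have := integrableZl measurableT L^-1 (iA n); apply: eq_integrable.
  apply: le_Rintegral => //.
  - by have := integrable_abse (iP n); apply: eq_integrable.
  - by have := integrableD measurableT (iF L n (ltW L0)) iLA; apply: eq_integrable.
  move=> q _; rewrite /F; case: (leP `|P n q| (L * B q)) => h.
    rewrite lerDl mulr_ge0 ?invr_ge0 ?(ltW L0)//.
    by rewrite /A -mulrA mulr_ge0// -expr2 sqr_ge0.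
  apply: le_trans (_ : L^-1 * A n q <= _); last first.
    by rewrite lerDr mulr_ge0// ltW.
  rewrite ler_pdivlMl//.
  move: h; rewrite /P /B /A !normrM (ger0_norm (w0 q)).
  rewrite -[w q * incr g q * incr g q]mulrA -[w q * incr (f_ n) q * incr (f_ n) q]mulrA.
  rewrite -!expr2 -(real_normK (num_real (incr g q))) -(real_normK (num_real (incr (f_ n) q))).
  move: (normr_ge0 (incr (f_ n) q)) (normr_ge0 (incr g q)) (w0 q).
  (* Where [L B < |P|], cancelling [c * b] gives [L * b < a], hence [L |P| <= A]. The strict
     inequality forces [b] and [c] to be nonzero. *)
  move: `|incr (f_ n) q| `|incr g q| (w q) => a b c a0 b0 c0 h.
  have cb0 : 0 < c * a * b.
    apply: le_lt_trans h; apply: mulr_ge0; first exact: ltW.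
    by apply: mulr_ge0 => //; exact: sqr_ge0.
  have c1 : 0 < c.
    rewrite lt_neqAle c0 andbT; apply/eqP => c00.
    by move: cb0; rewrite -c00 !mul0r ltxx.
  have b1 : 0 < b.
    rewrite lt_neqAle b0 andbT; apply/eqP => b00.
    by move: cb0; rewrite -b00 !mulr0 ltxx.
  have h' : L * b < a.
    rewrite -(ltr_pM2l (mulr_gt0 c1 b1)); apply: le_lt_trans (_ : L * (c * b ^+ 2) < _) => //.
      by rewrite le_eqVlt; apply/orP; left; apply/eqP; ring.
    by apply: lt_le_trans h _; rewrite le_eqVlt; apply/orP; left; apply/eqP; ring.
  have -> : L * (c * a * b) = c * a * (L * b) by ring.
  have -> : c * a ^+ 2 = c * a * a by ring.
  by apply: ler_wpM2l; [rewrite mulr_ge0|exact: ltW].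
apply: le_trans (ler_wpM2l (ltW C0) h1) _.
rewrite RintegralD//; last 2 first.
- exact: (iF L n (ltW L0)).
- by have := integrableZl measurableT L^-1 (iA n); apply: eq_integrable.
rewrite RintegralZl; [|by []|exact: iA].
rewrite mulrDr (splitr d); apply: lerD.
  by rewrite mulrC -ler_pdivlMr.
rewrite mulrCA.
apply: le_trans (ler_wpM2l _ (QA n)) _; first by rewrite invr_ge0 ltW.
rewrite /L -ler_pdivlMl ?invr_gt0 ?divr_gt0//; last by lra.
rewrite invrK.
have -> : 2 * (M + 1) / d * (d / 2) = M + 1 by field; lra.
lra.
Qed.
End Riesz.

(** * Real and imaginary parts of functions in C_c *)

Section ComplexFunctions.
Variable R : realType.
Implicit Types (f g : R -> R[i]) (u v : R -> R) (s : R).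

Definition rpart f : R -> R := fun x => complex.Re (f x).
Definition ipart f : R -> R := fun x => complex.Im (f x).
Definition cfun u : R -> R[i] := fun x => (u x)%:C.

Lemma normc_Im_le (z : R[i]) : `|complex.Im z|%:C <= `|z|.
Proof.
case: z => a b; rewrite normc_def lecR /=.
by rewrite -sqrtr_sqr ler_sqrt ?lerDr ?sqr_ge0// addr_ge0 ?sqr_ge0.
Qed.

Lemma pos_complexE (e : R[i]) : 0 < e -> e = (complex.Re e)%:C /\ 0 < complex.Re e.
Proof. by case: e => a b; rewrite ltcE /= => /andP[/eqP -> ->]. Qed.

Lemma continuous_rpart f : continuous (f : R -> (R[i] : numFieldType)) ->
  continuous (rpart f).
Proof.
move=> cf x; apply/cvgrPdist_lt => e e0.
have e0' : 0 < e%:C :> R[i] by rewrite ltcR.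
have /cvgrPdist_lt /(_ _ e0') := cf x.
apply: filterS => t; rewrite /rpart -raddfB -ltcR.
by apply: le_lt_trans; exact: normc_ge_Re.
Qed.

Lemma continuous_ipart f : continuous (f : R -> (R[i] : numFieldType)) ->
  continuous (ipart f).
Proof.
move=> cf x; apply/cvgrPdist_lt => e e0.
have e0' : 0 < e%:C :> R[i] by rewrite ltcR.
have /cvgrPdist_lt /(_ _ e0') := cf x.
apply: filterS => t; rewrite /ipart -raddfB -ltcR.
by apply: le_lt_trans; exact: normc_Im_le.
Qed.

Lemma continuous_cfun u : continuous u -> continuous (cfun u : R -> (R[i] : numFieldType)).
Proof.
move=> cu x; apply/cvgrPdist_lt => e /pos_complexE[-> e0].
have /cvgrPdist_lt /(_ _ e0) := cu x.
apply: filterS => t; rewrite /cfun -rmorphB /= normc_def /= expr0n/= addr0.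
by rewrite sqrtr_sqr ltcR.
Qed.

Lemma Cc_cfun u f : Cc f -> continuous u -> (forall x, f x = 0 -> u x = 0) ->
  Cc (cfun u).
Proof.
move=> [cf kf] cu uf; split; first exact: continuous_cfun.
apply: subclosed_compact kf _; first exact: closed_closure.
apply: closure_subset => x /=; apply: contra_neq => fx.
by rewrite /cfun uf.
Qed.

Lemma Cc_rpart f : Cc f -> Cc (cfun (rpart f)).
Proof.
move=> cf; apply: (Cc_cfun cf); first by case: cf => /continuous_rpart.
by rewrite /rpart => x ->.
Qed.

Lemma Cc_ipart f : Cc f -> Cc (cfun (ipart f)).
Proof.
move=> cf; apply: (Cc_cfun cf); first by case: cf => /continuous_ipart.
by rewrite /ipart => x ->.
Qed.

Lemma Cc_bsupp u f : Cc f -> continuous u -> (forall x, f x = 0 -> u x = 0) ->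
  bsupp u.
Proof.
move=> [cf kf] cu uf; set K := closure _ in kf.
have u0 x : ~ K x -> u x = 0.
  move=> Kx; apply: uf; apply/eqP; apply: contra_notT Kx => fx.
  exact: subset_closure.
have kuK : compact (u @` K).
  by apply: continuous_compact => //; exact: continuous_subspaceT.
have [A [_ hA]] := compact_bounded kf.
have [B [_ hB]] := compact_bounded kuK.
(* The boundedness statements hold for every constant strictly above [A], respectively [B]; adding 1
   gives this strictness and makes [N] positive. *)
pose N := Num.max (Num.max A B) 0 + 1.
have AN : A < N by rewrite /N ltr_pwDr// !le_max lexx.
have BN : B < N by rewrite /N ltr_pwDr// !le_max lexx orbT.
have N0 : 0 < N by rewrite /N ltr_wpDl// le_max lexx orbT.
exists N; split => //; first exact: continuous_measurable_fun.
move=> x; have [Kx|Kx] := pselect (K x); last first.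
  by rewrite (u0 _ Kx) normr0; case: ifP => // _; apply: ltW.
rewrite (hA _ AN _ Kx).
by apply: (hB _ BN); exists x.
Qed.

Lemma bsupp_rpart f : Cc f -> bsupp (rpart f).
Proof.
move=> cf; apply: (Cc_bsupp cf); first by case: cf => /continuous_rpart.
by rewrite /rpart => x ->.
Qed.

Lemma bsupp_ipart f : Cc f -> bsupp (ipart f).
Proof.
move=> cf; apply: (Cc_bsupp cf); first by case: cf => /continuous_ipart.
by rewrite /ipart => x ->.
Qed.

Lemma Cc_on_eq0 f e x : Cc_on `](- e), e[ f -> e <= `|x| -> f x = 0.
Proof.
move=> [_ h] ex; apply/eqP; apply: contraTT ex => fx.
have : closure [set x | f x != 0] x by exact: subset_closure.
by move=> /h; rewrite /= in_itv/= -ltr_norml -ltNge.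
Qed.

Lemma cintegral_cfun u : cintegral (cfun u) = (\int[lebesgue_measure]_x u x)%:C.
Proof. by rewrite /cintegral /= Rintegral_cst//= mul0r. Qed.

Lemma riesz_form_cfun s u v : riesz_form s (cfun u) (cfun v) = (rriesz s u v)%:C.
Proof.
rewrite /riesz_form /rriesz -cintegral_cfun; congr cintegral; apply/funext => y.
rewrite /cfun -[RHS]cintegral_cfun; congr cintegral; apply/funext => x.
by rewrite conj_Creal ?complex_real // /cfun !rmorphM.
Qed.
End ComplexFunctions.

(** * Norm and inner product of the Hilbert space *)

Section HilbertNorm.
Variables (R : realType) (H : completeNormedModType R[i]).
Variable dot : {dot H for Num.conj}.
Hypothesis hN : hilbert_norm dot.
Implicit Types (x y z : H) (c : R[i]).

(** The norm of [H] takes values in [R[i]], whose order is only partial; [nm] is the same number in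
    [R]. *)
Definition nm x : R := complex.Re `|x|.

Lemma nmE x : `|x| = (nm x)%:C.
Proof. by rewrite /nm RRe_real// ger0_real. Qed.

Lemma nm_ge0 x : 0 <= nm x.
Proof. by rewrite -ler0c -nmE. Qed.

Lemma nmD x y : nm (x + y) <= nm x + nm y.
Proof. by rewrite -lecR rmorphD /= -!nmE; exact: ler_normD. Qed.

Lemma nmN x : nm (- x) = nm x.
Proof. by rewrite /nm normrN. Qed.

Lemma nm0 : nm 0 = 0.
Proof. by rewrite /nm normr0. Qed.

Lemma nm_eq0 x : nm x = 0 -> x = 0.
Proof. by move=> h; apply: normr0_eq0; rewrite nmE h. Qed.

Lemma dotE x : dot x x = (nm x ^+ 2)%:C.
Proof. by rewrite -[LHS]hN nmE rmorphXn. Qed.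

Lemma dotC x y : dot x y = Num.conj (dot y x).
Proof. by rewrite hermC expr0 mul1r. Qed.

Lemma dotDl x y z : dot (x + y) z = dot x z + dot y z.
Proof. exact: linearDl. Qed.

Lemma dotDr x y z : dot x (y + z) = dot x y + dot x z.
Proof. exact: linearDr. Qed.

Lemma dotBl x y z : dot (x - y) z = dot x z - dot y z.
Proof. exact: linearBl. Qed.

Lemma dotZl c x y : dot (c *: x) y = c * dot x y.
Proof. exact: linearZl_LR. Qed.

Lemma dotZr c x y : dot x (c *: y) = Num.conj c * dot x y.
Proof. exact: linearZr_LR. Qed.

Lemma dot0r x : dot x 0 = 0.
Proof. exact: linear0r. Qed.

(** Cauchy-Schwarz by Pythagoras: [x] splits as [u + a *: y] with [u] orthogonal to [y], and the
    square norm of [u] is dropped. *)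
Lemma dot_norm_le x y : `|dot x y| <= (nm x * nm y)%:C.
Proof.
have [->|y0] := eqVneq y 0.
  by rewrite dot0r normr0 ler0c mulr_ge0 ?nm_ge0.
have dy : 0 < dot y y by apply: neq0_dnorm_gt0.
pose a := dot x y / dot y y.
have [u xE ou] : exists2 u, x = u + a *: y & dot u y = 0.
  exists (x - a *: y); first by rewrite subrK.
  by rewrite dotBl dotZl /a divfK ?subrr// gt_eqF.
have E : dot x x = dot u u + `|a| ^+ 2 * dot y y.
  rewrite xE dotDl !dotDr !dotZr !dotZl ou [dot y u]dotC ou rmorph0.
  by rewrite !mulr0 addr0 add0r mulrCA mulrA -normCK.
have h : `|dot x y| ^+ 2 <= (nm x * nm y)%:C ^+ 2.
  have -> : (nm x * nm y)%:C ^+ 2 = dot x x * dot y y.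
    by rewrite !dotE -rmorphXn -rmorphM exprMn.
  rewrite E mulrDl.
  have -> : `|a| ^+ 2 * dot y y * dot y y = `|dot x y| ^+ 2.
    by rewrite /a normrM normfV (gtr0_norm dy); field; rewrite gt_eqF.
  by rewrite lerDr !dotE -rmorphM ler0c mulr_ge0 ?sqr_ge0.
by move: h; rewrite ler_pXn2r// nnegrE ?ler0c ?mulr_ge0 ?nm_ge0.
Qed.

(** The cross terms are ['i * r] and [- 'i * r], and cancel because [dot x y] is real. *)
Lemma sqr_nm_imaginary x y (p q r : R) :
  dot x x = p%:C -> dot y y = q%:C -> dot x y = r%:C ->
  nm ('i *: y + x) ^+ 2 = p + q.
Proof.
move=> xx yy xy.
have yx : dot y x = r%:C by rewrite dotC xy; apply: conj_Creal; rewrite complex_real.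
apply: complexI; rewrite -dotE dotDl !dotDr !dotZl !dotZr xx yy xy yx conjCi.
rewrite [RHS]rmorphD /=.
by rewrite !mulNr mulrN mulrA -expr2 sqrCi mulN1r opprK addrA addrK addrC.
Qed.

Lemma closureP_nm (A : set H) x :
  closure A x <-> (forall e : R, 0 < e -> exists2 d, A d & nm (x - d) < e).
Proof.
split=> [cA e e0|h B].
  have e0' : 0 < e%:C :> R[i] by rewrite ltcR.
  have [d [Ad]] := cA _ (nbhsx_ballx x _ e0').
  by rewrite -ball_normE /= nmE ltcR => hd; exists d.
move=> /nbhs_ballP[e /= /pos_complexE[-> e0] hB].
have [d Ad hd] := h _ e0; exists d; split => //; apply: hB.
by rewrite -ball_normE /= nmE ltcR.
Qed.

Lemma cvg_nm0 (u : nat -> H) :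
  (forall e : R, 0 < e -> \forall n \near \oo, nm (u n) <= e) ->
  `|u n| @[n --> \oo] --> (0 : (R[i] : numFieldType)).
Proof.
move=> h; apply/cvgrPdist_le => e /pos_complexE[-> e0].
by have := h _ e0; apply: filterS => n; rewrite sub0r normrN normr_id nmE lecR.
Qed.

End HilbertNorm.

(** * Weak convergence of concentrating sequences *)

Lemma near_sum4_le (R : realType) (a b c d : nat -> R) (e : R) :
  (\forall n \near \oo, `|a n| <= e / 4) -> (\forall n \near \oo, `|b n| <= e / 4) ->
  (\forall n \near \oo, `|c n| <= e / 4) -> (\forall n \near \oo, `|d n| <= e / 4) ->
  \forall n \near \oo, `|a n| + `|b n| + `|c n| + `|d n| <= e.
Proof.
move=> ha hb hc hd; near=> n.
have h1 : `|a n| <= e / 4 by near: n.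
have h2 : `|b n| <= e / 4 by near: n.
have h3 : `|c n| <= e / 4 by near: n.
have h4 : `|d n| <= e / 4 by near: n.
lra.
Unshelve. all: by end_near. Qed.

Section WeakLimit.
Variables (R : realType) (H : completeNormedModType R[i]).
Variable dot : {dot H for Num.conj}.
Variables (s : R) (j : (R -> R[i]) -> H).
Hypotheses (s0 : 0 < s) (s1 : s < 1) (hH : Hs_completion dot s j).

Let hN := Hs_norm hH.

Lemma j_decomp f : Cc f -> j f = 'i *: j (cfun (ipart f)) + j (cfun (rpart f)).
Proof.
move=> cf; rewrite -(Hs_linear hH); [|exact: Cc_ipart|exact: Cc_rpart].
congr j; apply/funext => x; rewrite /cfun /ipart /rpart addrC -complexiE.
exact: complexE.
Qed.

(** The arguments are exchanged because [inner x y] is [dot y x]. *)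
Lemma dot_cfun u v : Cc (cfun u) -> Cc (cfun v) ->
  dot (j (cfun u)) (j (cfun v)) = (rriesz s v u)%:C.
Proof. by move=> cu cv; rewrite -riesz_form_cfun -(Hs_inner hH). Qed.

Lemma rriesz_ge0 u : Cc (cfun u) -> 0 <= rriesz s u u.
Proof. by move=> cu; rewrite -ler0c -dot_cfun// dotE// ler0c sqr_ge0. Qed.

Lemma rriesz_sym u v : Cc (cfun u) -> Cc (cfun v) -> rriesz s u v = rriesz s v u.
Proof.
move=> cu cv; apply: complexI.
rewrite -[RHS](dot_cfun cu cv) -[LHS](dot_cfun cv cu) dotC (dot_cfun cu cv).
by apply: conj_Creal; rewrite complex_real.
Qed.

Lemma rriesz_part_le f M : Cc f -> nm (j f) <= M ->
  rriesz s (rpart f) (rpart f) <= M ^+ 2 /\ rriesz s (ipart f) (ipart f) <= M ^+ 2.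
Proof.
move=> cf fM.
have cr := Cc_rpart cf; have ci := Cc_ipart cf.
have h : nm (j f) ^+ 2 = rriesz s (rpart f) (rpart f) + rriesz s (ipart f) (ipart f).
  rewrite j_decomp//; apply: (sqr_nm_imaginary hN); exact: dot_cfun.
have r0 := rriesz_ge0 cr; have i0 := rriesz_ge0 ci.
have n0 := nm_ge0 (j f).
have : nm (j f) ^+ 2 <= M ^+ 2 by rewrite ler_pXn2r// nnegrE// (le_trans n0).
rewrite h => hh; split; apply: le_trans hh.
  rewrite lerDl; exact: i0.
rewrite lerDr; exact: r0.
Qed.

(** Splitting both arguments into real and imaginary parts leaves four real forms. Each tends to 0
    by [rriesz_cvg0], since the norm bound passes to the parts. *)
Lemma weak_cvg0 (f_ : nat -> R -> R[i]) g (e_ : nat -> R) M :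
  (forall n, 0 < e_ n) -> e_ n @[n --> \oo] --> 0 ->
  (forall n, Cc_on `](- e_ n), e_ n[ (f_ n)) -> Cc g ->
  (forall n, nm (j (f_ n)) <= M) ->
  forall e : R, 0 < e -> \forall n \near \oo, `|dot (j (f_ n)) (j g)| <= e%:C.
Proof.
move=> e0 ecvg fe cg fM e ep.
have cf n : Cc (f_ n) by case: (fe n).
have f0 n x : e_ n <= `|x| -> f_ n x = 0 by apply: Cc_on_eq0.
have e4 : 0 < e / 4 by rewrite divr_gt0.
have lim (p : (R -> R[i]) -> R -> R) v : bsupp v ->
    (forall n, bsupp (p (f_ n))) ->
    (forall n x, f_ n x = 0 -> p (f_ n) x = 0) ->
    (forall n, rriesz s (p (f_ n)) (p (f_ n)) <= M ^+ 2) ->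
    \forall n \near \oo, `|rriesz s (p (f_ n)) v| <= e / 4.
  move=> bv bp p0 pM.
  have /cvgrPdist_le /(_ _ e4) : rriesz s (p (f_ n)) v @[n --> \oo] --> 0.
    apply: (rriesz_cvg0 s0 s1 bp bv e0 ecvg _ pM) => n x /f0; exact: p0.
  by apply: filterS => n; rewrite sub0r normrN.
have Lr v : bsupp v -> \forall n \near \oo, `|rriesz s (rpart (f_ n)) v| <= e / 4.
  move=> bv; apply: (lim (@rpart R)) => //.
  - by move=> n; exact: bsupp_rpart.
  - by move=> n x h; rewrite /rpart h.
  - by move=> n; have [] := rriesz_part_le (cf n) (fM n).
have Li v : bsupp v -> \forall n \near \oo, `|rriesz s (ipart (f_ n)) v| <= e / 4.
  move=> bv; apply: (lim (@ipart R)) => //.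
  - by move=> n; exact: bsupp_ipart.
  - by move=> n x h; rewrite /ipart h.
  - by move=> n; have [] := rriesz_part_le (cf n) (fM n).
have h1 := Lr _ (bsupp_rpart cg); have h2 := Lr _ (bsupp_ipart cg).
have h3 := Li _ (bsupp_rpart cg); have h4 := Li _ (bsupp_ipart cg).
have := near_sum4_le h1 h2 h3 h4.
apply: filterS => n hn; move: hn.
rewrite (j_decomp (cf n)) (j_decomp cg) dotDl !dotDr !dotZl !dotZr.
have cr := Cc_rpart (cf n); have ci := Cc_ipart (cf n).
have dr := Cc_rpart cg; have di := Cc_ipart cg.
rewrite (dot_cfun ci di) (dot_cfun cr dr) (dot_cfun ci dr) (dot_cfun cr di).
(* Symmetry moves the varying function to the first slot, as in [h1] to [h4]. *)
rewrite (rriesz_sym di ci) (rriesz_sym dr ci) (rriesz_sym di cr) (rriesz_sym dr cr).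
move: (rriesz s (rpart (f_ n)) (rpart g)) (rriesz s (rpart (f_ n)) (ipart g)).
move: (rriesz s (ipart (f_ n)) (rpart g)) (rriesz s (ipart (f_ n)) (ipart g)).
move=> p q r t h.
have nr (x : R) : `|x%:C| = `|x|%:C :> R[i].
  by rewrite normc_def /= expr0n/= addr0 sqrtr_sqr.
have ni : `|'i : R[i]| = 1 by rewrite normCi.
have nci : `|Num.conj ('i : R[i])| = 1 by rewrite norm_conjC normCi.
apply: (@le_trans _ _ (`|q|%:C + `|p|%:C + (`|t|%:C + `|r|%:C))).
  apply: le_trans (ler_normD _ _) _; apply: lerD.
    by apply: le_trans (ler_normD _ _) _; rewrite !normrM ni nci !mul1r !nr.
  by apply: le_trans (ler_normD _ _) _; rewrite !normrM nci !mul1r !nr.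
by rewrite -!rmorphD lecR; lra.
Qed.
End WeakLimit.

(** * Dilations and the supports of functions in C_c *)

Section Dilation.
Variable R : realType.
Implicit Types (f : R -> R[i]) (s a e : R).

Lemma Cc_on_dilation s a e f : 1 < a ->
  Cc_on `](- e), e[ f -> Cc_on `](- (e / a ^+ 2)), (e / a ^+ 2)[ (dilation s a f).
Proof.
move=> a1 [[cf kf] fe]; set K := closure _ in kf fe.
have a0 : 0 < a ^+ 2 by rewrite exprn_gt0// (lt_trans ltr01).
pose h := fun x : R => x / a ^+ 2.
have ch : continuous h by move=> x; apply: cvgMl; exact: cvg_id.
have khK : compact (h @` K) by apply: continuous_compact => //; exact: continuous_subspaceT.
have clhK : closed (h @` K) by apply: compact_closed khK; exact: Rhausdorff.
(* The rescaled copy of [K] is compact, hence closed, so it contains the closure of the new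
   nonvanishing set and not only the set itself. *)
have sub : closure [set x | dilation s a f x != 0] `<=` h @` K.
  rewrite [X in _ `<=` X]((closure_id _).1 clhK); apply: closure_subset => x /=.
  rewrite /dilation mulf_eq0 negb_or => /andP[_ fx].
  exists (a ^+ 2 * x); first exact: subset_closure.
  by rewrite /h mulrC mulKf// gt_eqF.
split; last first.
  move=> _ /sub[y /fe /= + <-]; rewrite /= !in_itv/= => /andP[y1 y2].
  by rewrite /h -mulNr !ltr_pM2r ?invr_gt0// y1.
split; last exact: (subclosed_compact (@closed_closure _ _) khK sub).
move=> x; rewrite /dilation; apply: cvgM; first exact: cvg_cst.
apply: (@continuous_comp _ _ _ (fun x : R => a ^+ 2 * x) (f : R -> (R[i] : numFieldType))).
  by apply: cvgMr; exact: cvg_id.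
exact: cf.
Qed.

Lemma Cc_on_le e e' f : e <= e' -> Cc_on `](- e), e[ f -> Cc_on `](- e'), e'[ f.
Proof.
move=> ee' [cf h]; split => // x /h /=; rewrite !in_itv/= => /andP[x1 x2].
by rewrite (lt_le_trans x2 ee') andbT (le_lt_trans _ x1)// lerN2.
Qed.

Lemma Cc_on_iter_dilation s a e f n : 1 < a ->
  Cc_on `](- e), e[ f ->
  Cc_on `](- (e * (a ^- 2) ^+ n)), (e * (a ^- 2) ^+ n)[ (iter n (dilation s a) f).
Proof.
move=> a1 fe; elim: n => [|n IH]; first by rewrite expr0 mulr1.
by rewrite exprSr mulrA; apply: Cc_on_dilation.
Qed.

Lemma Cc_on_linear (O : set R) (c : R[i]) f g : Cc_on O f -> Cc_on O g ->
  Cc_on O (fun x => c * f x + g x).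
Proof.
move=> [[cf kf] fO] [[cg kg] gO].
have sub : closure [set x | c * f x + g x != 0] `<=`
    closure [set x | f x != 0] `|` closure [set x | g x != 0].
  rewrite -closureU; apply: closure_subset => x /=.
  have [->|fx] := eqVneq (f x) 0; last by left.
  by rewrite mulr0 add0r; right.
split; last by move=> x /sub[/fO|/gO].
split.
  move=> x; apply: cvgD; last exact: cg.
  by apply: cvgM; [exact: cvg_cst|exact: cf].
by apply: subclosed_compact sub; [exact: closed_closure|exact: compactU].
Qed.

Lemma Cc_on0 (O : set R) : Cc_on O (fun=> 0 : R[i]).
Proof.
have E : closure [set x : R | (0 : R[i]) != 0] = set0.
  by rewrite (_ : [set x | _] = set0) ?closure0// -subset0 => x /=; rewrite eqxx.
split; last by rewrite /= E.
by split; [move=> x; exact: cvg_cst|rewrite /= E; exact: compact0].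
Qed.
End Dilation.

(** * The isometry on K_s, its adjoint and its wandering subspace *)

Section Shift.
Variables (R : realType) (s a : R).
Hypotheses (hs0 : 0 < s) (hs1 : s < 1) (ha : 1 < a).
Variables (H : completeNormedModType R[i]) (dot : {dot H for Num.conj}).
Variables (j : (R -> R[i]) -> H) (hH : Hs_completion dot s j).
Variables (U : H -> H) (hU : unitary dot U).
Hypothesis hUa : forall f : R -> R[i], Cc f -> U (j f) = j (dilation s a f).
Variables (P : H -> H) (hP : orthogonal_projection dot (Ks j) P).
Let hN := Hs_norm hH.
Let K := Ks j.

Lemma unitaryD x y : U (x + y) = U x + U y.
Proof. by case: hU => Ul _ _; have := Ul 1 x y; rewrite !scale1r. Qed.

Lemma unitaryZ c x y : U (c *: x + y) = c *: U x + U y.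
Proof. by case: hU => Ul _ _; exact: Ul. Qed.

Lemma unitary0 : U 0 = 0.
Proof. by apply: (addrI (U 0)); rewrite -unitaryD !addr0. Qed.

Lemma unitaryB x y : U (x - y) = U x - U y.
Proof. by apply: (addIr (U y)); rewrite -unitaryD !subrK. Qed.

Lemma dot_unitary x y : dot (U x) (U y) = dot x y.
Proof. by case: hU => _ h _; exact: h. Qed.

Lemma nm_unitary x : nm (U x) = nm x.
Proof.
apply: (pexpIrn (n := 2)); rewrite ?nnegrE ?nm_ge0//.
by apply: complexI; rewrite -!(dotE hN) dot_unitary.
Qed.

Lemma nm_iter_unitary n x : nm (iter n U x) = nm x.
Proof. by elim: n => // n IH; rewrite iterS nm_unitary. Qed.

Lemma iter_unitaryD n x y : iter n U (x + y) = iter n U x + iter n U y.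
Proof. by elim: n => // n IH; rewrite !iterS IH unitaryD. Qed.

Lemma iter_unitaryB n x y : iter n U (x - y) = iter n U x - iter n U y.
Proof. by elim: n => // n IH; rewrite !iterS IH unitaryB. Qed.

Lemma Ks_proj x : K (P x).
Proof. by case: (hP x). Qed.

Lemma dot_proj x y : K y -> dot (P x) y = dot x y.
Proof.
move=> Ky; case: (hP x) => _ /(_ _ Ky); rewrite /inner dotBl => /eqP.
by rewrite subr_eq0 => /eqP.
Qed.

Lemma Ks_linear c x y : K x -> K y -> K (c *: x + y).
Proof.
move=> /closureP_nm Kx /closureP_nm Ky; apply/closureP_nm => e e0.
(* One more than the modulus of [c], so that division by [m] is safe when [c = 0]. *)
pose m := complex.Re `|c| + 1.
have m0 : 0 < m.
  have : 0 <= complex.Re `|c| by rewrite -ler0c RRe_real ?ger0_real.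
  by rewrite /m; lra.
have e1 : 0 < e / 2 / m by rewrite !divr_gt0.
have e2 : 0 < e / 2 by rewrite divr_gt0.
have [_ [f /= Kf <-] xf] := Kx _ e1.
have [_ [g /= Kg <-] yg] := Ky _ e2.
exists (c *: j f + j g).
  exists (fun x => c * f x + g x); first exact: Cc_on_linear.
  by rewrite (Hs_linear hH)//; [case: Kf|case: Kg].
have -> : c *: x + y - (c *: j f + j g) = c *: (x - j f) + (y - j g).
  by rewrite scalerBr opprD addrACA.
apply: le_lt_trans (nmD _ _) _.
rewrite (splitr e); apply: ltrD => //.
have -> : nm (c *: (x - j f)) = complex.Re `|c| * nm (x - j f).
  apply: complexI; rewrite -nmE normrZ [RHS]rmorphM /=.
  by rewrite nmE.
apply: le_lt_trans (_ : m * nm (x - j f) < _).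
  by apply: ler_wpM2r; [exact: nm_ge0|rewrite /m; lra].
by rewrite mulrC -ltr_pdivlMr.
Qed.

Lemma Ks0 : K 0.
Proof.
apply/closureP_nm => e e0; exists (j (fun=> 0)).
  by exists (fun=> 0) => //; exact: Cc_on0.
have cc : Cc (fun=> 0 : R[i]) by case: (@Cc_on0 R setT).
(* With factor -1 and both functions zero, linearity reads [j 0 = - j 0 + j 0], so [j 0 = 0]. *)
have := Hs_linear hH (-1) cc cc.
rewrite scaleN1r addNr.
have -> : (fun x : R => -1 * (0 : R[i]) + 0) = (fun=> 0).
  by apply/funext => x; rewrite mulr0 addr0.
by move=> ->; rewrite subr0 nm0.
Qed.

Lemma KsB x y : K x -> K y -> K (x - y).
Proof. by move=> Kx Ky; rewrite addrC -scaleN1r; exact: Ks_linear. Qed.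

Lemma Ks_unitary x : K x -> K (U x).
Proof.
move=> /closureP_nm Kx; apply/closureP_nm => e e0.
have [_ [f /= Kf <-] xf] := Kx _ e0.
exists (U (j f)); last by rewrite -unitaryB nm_unitary.
have cf : Cc f by case: Kf.
rewrite (hUa cf); exists (dilation s a f) => //.
apply: Cc_on_le (Cc_on_dilation s ha Kf).
have a2 : 1 < a ^+ 2 by rewrite expr2 -[ltLHS]mulr1 ltr_pM// ltW.
by rewrite ler_pdivrMr ?mul1r ?(ltW a2)// (lt_trans ltr01).
Qed.

Lemma Ks_iter_unitary n x : K x -> K (iter n U x).
Proof. by move=> Kx; elim: n => // n IH; rewrite iterS; exact: Ks_unitary. Qed.

Lemma proj_id x : K x -> P x = x.
Proof.
move=> Kx; apply/esym/eqP; rewrite -subr_eq0; apply/eqP/nm_eq0.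
have Kd : K (x - P x) by apply: KsB => //; exact: Ks_proj.
have h : dot (x - P x) (x - P x) = 0 by rewrite dotBl dot_proj// subrr.
move: h; rewrite (dotE hN) => /complexI /eqP.
by rewrite sqrf_eq0 => /eqP.
Qed.

(** Cauchy-Schwarz for [dot x (P x)], which equals the square norm of [P x]. *)
Lemma nm_proj_le x : nm (P x) <= nm x.
Proof.
have [-> //|p0] := eqVneq (nm (P x)) 0; first exact: nm_ge0.
have p1 : 0 < nm (P x) by rewrite lt_neqAle eq_sym p0 nm_ge0.
have := dot_norm_le hN x (P x).
rewrite -(dot_proj x (@Ks_proj x)) (dotE hN) ger0_norm ?ler0c ?sqr_ge0//.
by rewrite lecR expr2 ler_pM2r.
Qed.

Lemma unitary_right_inverse : exists Ui : H -> H, cancel Ui U.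
Proof.
case: hU => _ _ Us.
by have [Ui h] := choice Us; exists Ui.
Qed.

Section Adjoint.
Variables (Ui : H -> H) (UiK : cancel Ui U).
(** On K_s this is the adjoint [V^*]: the inverse of [U] compressed back to K_s. *)
Definition backshift x := P (Ui x).

Lemma dot_right_inverse x y : dot (Ui x) y = dot x (U y).
Proof. by rewrite -dot_unitary UiK. Qed.

Lemma dot_backshift n x y : K y -> dot (iter n backshift x) y = dot x (iter n U y).
Proof.
move=> Ky; elim: n y Ky => // n IH y Ky.
rewrite iterS /backshift dot_proj// dot_right_inverse IH; last exact: Ks_unitary.
by rewrite -iterSr.
Qed.

Lemma Ks_backshift n x : K x -> K (iter n backshift x).
Proof. by move=> Kx; case: n => // n; rewrite iterS; exact: Ks_proj. Qed.

Lemma nm_backshift n x : nm (iter n backshift x) <= nm x.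
Proof.
elim: n => // n IH; rewrite iterS; apply: le_trans IH.
apply: le_trans (nm_proj_le _) _; rewrite -nm_unitary UiK.
exact: lexx.
Qed.

Lemma backshift_cvg0 x (e : R) : K x -> 0 < e ->
  \forall n \near \oo, nm (iter n backshift x) <= e.
Proof.
move=> Kx e0.
set X := nm x; have X0 : 0 <= X by apply: nm_ge0.
(* The three errors below add up to [d * (2 * X + 2)], which must not exceed [e^2]; [d <= 1] keeps
   the norms of the approximants below [X + 1]. *)
pose d := Num.min 1 (e ^+ 2 / (2 * X + 2)).
have d0 : 0 < d.
  by rewrite lt_min ltr01 divr_gt0 ?exprn_gt0//; lra.
have d1 : d <= 1 by rewrite ge_min lexx.
have de : d * (2 * X + 2) <= e ^+ 2.
  rewrite -ler_pdivlMr; last by lra.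
  by rewrite ge_min lexx orbT.
have [_ [g /= Kg <-] xg] := (closureP_nm _ _).1 Kx _ d0.
have cg : Cc g by case: Kg.
(* The approximant changes with [n]; only the common support interval and the uniform norm bound
   matter, since [n] dilations then shrink the support to radius [e_ n]. *)
have /choice[F hF] : forall n, exists f, Cc_on `](- 1), 1[ f /\ nm (iter n backshift x - j f) < d.
  move=> n; have [_ [f /= Kf <-] xf] := (closureP_nm _ _).1 (@Ks_backshift n _ Kx) _ d0.
  by exists f.
pose e_ n := 1 * (a ^- 2) ^+ n.
pose f_ n := iter n (dilation s a) (F n).
have fe n : Cc_on `](- e_ n), e_ n[ (f_ n).
  by apply: Cc_on_iter_dilation => //; case: (hF n).
have jf n : j (f_ n) = iter n U (j (F n)).
  rewrite /f_; have [Kf _] := hF n.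
  elim: n (F n) Kf => // n IH f Kf; rewrite !iterS -IH// hUa//.
  by case: (Cc_on_iter_dilation s n ha Kf).
have en0 n : 0 < e_ n by rewrite /e_ mul1r exprn_gt0// invr_gt0 exprn_gt0// (lt_trans ltr01).
have ecvg : e_ n @[n --> \oo] --> 0.
  apply: (@cvg_geometric R 1 (a ^- 2)); rewrite gtr0_norm ?invr_gt0 ?exprn_gt0 ?(lt_trans ltr01)//.
  rewrite invf_lt1 ?exprn_gt0 ?(lt_trans ltr01)//.
  by rewrite expr2 -[ltLHS]mulr1 ltr_pM// ltW.
have jM n : nm (j (f_ n)) <= X + 1.
  rewrite jf nm_iter_unitary.
  have [_ h] := hF n.
  have -> : j (F n) = iter n backshift x - (iter n backshift x - j (F n)) by rewrite subKr.
  apply: le_trans (nmD _ _) _; rewrite nmN; apply: lerD; first exact: nm_backshift.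
  by apply: le_trans (ltW h) _.
have := weak_cvg0 hs0 hs1 hH en0 ecvg fe cg jM d0.
apply: filterS => n hn.
set y := iter n backshift x.
have Ky : K y by apply: Ks_backshift.
have [_ h] := hF n; rewrite -/y in h.
have yX : nm y <= X by apply: nm_backshift.
rewrite -(ler_pXn2r (n := 2))// ?nnegrE ?nm_ge0 ?(ltW e0)//.
rewrite -lecR -(dotE hN).
have -> : dot y y = dot x (iter n U y) by rewrite {1}/y dot_backshift.
have -> : iter n U y = iter n U (y - j (F n)) + j (f_ n) by rewrite jf -iter_unitaryD subrK.
rewrite dotDr.
have -> : dot x (j (f_ n)) = dot (x - j g) (j (f_ n)) + dot (j g) (j (f_ n)).
  by rewrite -dotDl subrK.
(* Recombining the sum into [dot y y] shows that it is a nonnegative real, so it equals its modulus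
   and the triangle inequality can be used. *)
have real_sq : dot x (iter n U (y - j (F n))) +
    (dot (x - j g) (j (f_ n)) + dot (j g) (j (f_ n))) = dot y y.
  by rewrite -dotDl subrK -dotDr jf -iter_unitaryD subrK -dot_backshift.
rewrite -[leLHS]ger0_norm; last first.
  by rewrite real_sq (dotE hN) ler0c sqr_ge0.
apply: le_trans (ler_normD _ _) _.
(* The terms come from replacing [y] by [j (F n)], from replacing [x] by [j g], and from the weak
   limit. *)
apply: (@le_trans _ _ ((X * d)%:C + ((d * (X + 1))%:C + d%:C))).
  apply: lerD.
    apply: le_trans (dot_norm_le hN _ _) _; rewrite lecR nm_iter_unitary.
    by apply: ler_wpM2l => //; exact: ltW.
  apply: le_trans (ler_normD _ _) _; apply: lerD.
    apply: le_trans (dot_norm_le hN _ _) _; rewrite lecR.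
    by apply: ler_pM; rewrite ?nm_ge0// ltW.
  by rewrite dotC norm_conjC.
rewrite -!rmorphD lecR; apply: le_trans de; lra.
Qed.

Lemma shiftE x : K x -> (U \o P) x = U x.
Proof. by move=> Kx; rewrite /= proj_id. Qed.

Lemma iter_shiftE n x : K x -> iter n (U \o P) x = iter n U x.
Proof.
move=> Kx; elim: n => // n IH; rewrite !iterS IH shiftE//; exact: Ks_iter_unitary.
Qed.

Lemma Ks_closed_subspace : closed_subspace K.
Proof. by split; [exact: closed_closure|exact: Ks0|exact: Ks_linear]. Qed.

(** [U (backshift x)] is [V V^* x], the projection of [x] onto the range of [V], so the difference
    is orthogonal to that range. *)
Lemma wandering_defect x : K x -> wandering dot K (U \o P) (x - U (backshift x)).
Proof.
move=> Kx; have Kb := @Ks_proj (Ui x); split; first by apply: KsB => //; exact: Ks_unitary.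
move=> y Ky; rewrite /inner shiftE// dotBl dot_unitary dot_proj// dot_right_inverse.
exact: subrr.
Qed.

(** A closed subspace [M] containing all images of the wandering subspace contains each telescoping
    sum [x - V^n V^*n x]. The remainder has the norm of [V^*n x], which tends to 0, so [x] lies in
    [M]. *)
Lemma Ks_closed_span : K = closed_span (\bigcup_n (iter n (U \o P) @` wandering dot K (U \o P))).
Proof.
apply/seteqP; split => x; last first.
  move=> /(_ K Ks_closed_subspace); apply => _ [n _ [z [Kz _] <-]].
  by rewrite iter_shiftE//; exact: Ks_iter_unitary.
move=> Kx M [clM M0 Ml] hM.
have MD y z : M y -> M z -> M (y + z).
  by move=> My Mz; rewrite -[y]scale1r; exact: Ml.
have Mn n : M (x - iter n U (iter n backshift x)).
  elim: n => [|n IH]; first by rewrite subrr.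
  set z := iter n backshift x in IH *.
  have Kz : K z by apply: Ks_backshift.
  have -> : x - iter n.+1 U (iter n.+1 backshift x) =
      x - iter n U z + iter n U (z - U (backshift z)).
    by rewrite iter_unitaryB iterSr [iter n.+1 backshift x]iterS addrA subrK.
  apply: MD => //; apply: hM; exists n => //.
  exists (z - U (backshift z)); first exact: wandering_defect.
  by rewrite iter_shiftE//; have [] := wandering_defect Kz.
rewrite ((closure_id _).1 clM); apply/closureP_nm => e e0.
have e2 : 0 < e / 2 by rewrite divr_gt0.
have [n _ hn] := backshift_cvg0 Kx e2.
exists (x - iter n U (iter n backshift x)) => //.
rewrite subKr nm_iter_unitary; apply: le_lt_trans (hn n _) _ => //=.
by lra.
Qed.
End Adjoint.
End Shift.

Theorem proposition1p1 (R : realType) (s a : R)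
    (hs0 : 0 < s) (hs1 : s < 1) (ha : 1 < a)
    (H : completeNormedModType R[i]) (dot : {dot H for Num.conj})
    (j : (R -> R[i]) -> H) (hH : Hs_completion dot s j)
    (U : H -> H) (hU : unitary dot U)
    (hUa : forall f : R -> R[i], Cc f -> U (j f) = j (dilation s a f))
    (P : H -> H) (hP : orthogonal_projection dot (Ks j) P) :
  [/\ (forall phi : H, Ks j phi -> (U \o P) phi = U phi),
      pure_shift dot (Ks j) (U \o P) &
      exists Vs : H -> H, adjoint_on dot (Ks j) (U \o P) Vs /\
        forall phi : H, Ks j phi ->
          `|iter k Vs phi| @[k --> \oo] --> (0 : (R[i] : numFieldType))].
Proof.
have [Ui UiK] := unitary_right_inverse hU.
have VK phi : Ks j phi -> (U \o P) phi = U phi by exact: (shiftE hH U hP).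
have KU := Ks_unitary ha hH hU hUa.
have K0 : Ks j 0 := Ks0 hH.
have KP x : Ks j (P x) by exact: (Ks_proj hP).
split => //.
- split.
    split => [x Kx|c x y Kx Ky|x Kx].
    + by rewrite VK//; exact: KU.
    + by rewrite !VK//; [exact: (unitaryZ hU)|exact: (Ks_linear hH)].
    + by rewrite VK// !nmE (nm_unitary hH hU).
  (* The unitary summand is zero and the shift summand is all of K_s; the spanning property is the
     only condition that uses the convergence of the adjoint powers. *)
  exists [set 0], (Ks j); split => //; split.
  + split => //.
      apply: accessible_closed_set1; apply: hausdorff_accessible.
      exact: norm_hausdorff.
    by move=> c x y -> ->; rewrite scaler0 addr0.
  + exact: (Ks_closed_subspace hH).
  + by move=> x y -> _; rewrite /inner dot0r.
  + apply/seteqP; split => [x Kx|_ [_ -> [p Kp <-]]]; last by rewrite add0r.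
    by exists 0 => //; exists x => //; rewrite add0r.
  + apply/seteqP; split => [_ [_ -> <-]|_ ->] /=.
      by rewrite (proj_id hH hP K0) (unitary0 hU).
    by exists 0 => //=; rewrite (proj_id hH hP K0) (unitary0 hU).
  + by move=> _ [x Kx <-]; rewrite VK//; exact: KU.
  + exact: (Ks_closed_span hs0 hs1 ha hH hU hUa hP UiK).
- exists (backshift P Ui); split; first split.
  + by move=> y _; exact: KP.
  + by move=> x y Kx Ky; rewrite /inner VK// /backshift (dot_proj hP)// (dot_right_inverse hU UiK).
  + move=> phi Kphi; apply: cvg_nm0 => e e0.
    exact: (backshift_cvg0 hs0 hs1 ha hH hU hUa hP UiK).
Qed.
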